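(* For every $j \in \{1, \ldots, n-1\}$, the set $B_j := \{ s_{j,k} \mid k = 1, \ldots, \beta_j \}$, where $\beta_j = j\binom{n}{j+1}$, is equal to \[ B'_j := \left\{ k\, c + a_{i_1} + \cdots + a_{i_{j+1}} \ \mid\ k \in \{1, \ldots, j\} \text{ and } 1 < i_1 < \cdots < i_{j+1} \leq n+1 \right\}. \]
   Context: Let $\Bbbk$ be an arbitrary field and let $b > 1$, $n > 1$, $a > 1$ be integers. Put $a_1 = \sum_{j=0}^{n-1} b^j$ and $a_i = a_{i-1} + a\, b^{i-2}$ for $i = 2, \ldots, n$, and assume $\gcd(a, a_1) = 1$. Let $S \subset \mathbb{N}$ be the numerical semigroup generated by $A = \{a_1, \ldots, a_n\}$ (a generalized repunit numerical semigroup; $A$ is its minimal generating system). Put also $a_{n+1} = (a+1)a_1$ and $c = b^n - 1 - a$. Let $\Bbbk[\mathbf{x}] = \Bbbk[x_1, \ldots, x_n]$, graded by $S$ via $\deg(x_i) = a_i$, let $\Bbbk[S] = \bigoplus_{s \in S} \Bbbk\chi^s$ be the semigroup algebra, and regard $\Bbbk[S] \cong \Bbbk[\mathbf{x}]/I_A$ as an $S$-graded $\Bbbk[\mathbf{x}]$-module, where $I_A$ is the kernel of $\Bbbk[\mathbf{x}] \to \Bbbk[S]$, $x_i \mapsto \chi^{a_i}$. For an integer $s$, $\Bbbk[\mathbf{x}](-s)$ denotes the free module of rank one whose basis element $1$ has degree $s$. The minimal $S$-graded free resolution of $\Bbbk[S]$ has the form \[ 0 \to \bigoplus_{k=1}^{\beta_{n-1}}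 \Bbbk[\mathbf{x}](-s_{n-1,k}) \to \cdots \to \bigoplus_{k=1}^{\beta_1} \Bbbk[\mathbf{x}](-s_{1,k}) \to \Bbbk[\mathbf{x}] \to \Bbbk[S] \to 0 \] with all maps homogeneous of degree $0$ and $\beta_j = j\binom{n}{j+1}$. This defines the integers $s_{j,k}$, uniquely up to reordering in $k$ for each $j$: the number of $k$ with $s_{j,k} = s$ is $\dim_{\Bbbk} \operatorname{Tor}_j^{\Bbbk[\mathbf{x}]}(\Bbbk, \Bbbk[S])_s$. *)

(* Defs.v *)
From HB Require Import structures.
From mathcomp Require Export all_boot all_order all_algebra.
From mathcomp Require Export mpoly.

Set Implicit Arguments.
Unset Strict Implicit.
Unset Printing Implicit Defensive.

Import Order.TTheory GRing.Theory Num.Theory.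

Local Open Scope ring_scope.

(* Generators a_i, i = 1, 2, ... with the 1-based indices of the mathematics;
   the value at 0 is junk. *)
Fixpoint repunit_gen (b n a i : nat) : nat :=
  match i with
  | 0 => 0
  | 1 => \sum_(0 <= j < n) b ^ j
  | (i'.+1 as i1).+1 => repunit_gen b n a i1 + a * b ^ i'
  end%N.

(* a_1, ..., a_n together with a_{n+1} = (a + 1) a_1. *)
Definition repunit_ext (b n a i : nat) : nat :=
  (if i == n.+1 then a.+1 * repunit_gen b n a 1 else repunit_gen b n a i)%N.

(* c may be negative, hence the use of int. *)
Definition repunit_c (b n a : nat) : int := (b ^ n)%N%:Z - 1 - a%:Z.

(* The variable x_{i+1} of k[x_1, ..., x_n] is 'X_i with i : 'I_n. *)
Definition repunit_weight (b n a : nat) (i : 'I_n) : nat :=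
  repunit_gen b n a i.+1.

Section Resolution.

Variables (k : fieldType) (n : nat) (w : 'I_n -> nat).

Local Notation kx := {mpoly k[n]}.

Definition wdeg (m : 'X_{1..n}) : nat := (\sum_(i < n) m i * w i)%N.

(* Degrees are integers: a difference of two shifts may be negative, in which
   case only 0 is homogeneous of that degree. *)
Definition whomog (s : int) (p : kx) : Prop :=
  forall m, m \in msupp p -> (wdeg m)%:Z = s.

Definition in_semigroup (s : nat) : Prop := exists m : 'X_{1..n}, wdeg m = s.

(* k[S] as the subalgebra of k[t] spanned by the chi^s = t^s, s in S. *)
Definition in_semigroup_algebra (f : {poly k}) : Prop :=
  forall s, f`_s != 0 -> in_semigroup s.

Definition semigroup_map (p : kx) : {poly k} :=
  mmap (@polyC k) (fun i => 'X^(w i)) p.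

Definition free_rank (rk : nat -> nat) (j : nat) : nat :=
  if j is 0 then 1 else rk j.

(* Minimal graded free resolution of k[S] with F_0 = k[x]:
     ... -> F_2 -> F_1 -> F_0 = k[x] -> k[S] -> 0,
   where F_j = \bigoplus_l k[x](- res_shift j l) is the module of row vectors,
   and F_(j+1) -> F_j is v |-> v *m res_diff j.  The complex is indexed by all
   j; it has finite length when the ranks vanish from some point on. *)
Record min_graded_resolution := MinGradedResolution {
  res_rank : nat -> nat;
  res_shift : forall j, 'I_(free_rank res_rank j) -> int;
  res_diff : forall j,
    'M[kx]_(free_rank res_rank j.+1, free_rank res_rank j);
  res_shift0 : forall l, @res_shift 0 l = 0;
  res_homog : forall j l l',
    whomog (@res_shift j.+1 l - @res_shift j l') (res_diff j l l');
  res_exact_aug : forall f : {poly k},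
    in_semigroup_algebra f <-> exists p : kx, semigroup_map p = f;
  res_exact0 : forall p : kx,
    semigroup_map p = 0 <->
    exists v : 'rV_(free_rank res_rank 1), v *m res_diff 0 = const_mx p;
  res_exact : forall j (v : 'rV_(free_rank res_rank j.+1)),
    v *m res_diff j = 0 <->
    exists u : 'rV_(free_rank res_rank j.+2), u *m res_diff j.+1 = v;
  (* minimality: the image of F_(j+1) lies in (x_1, ..., x_n) F_j, i.e. the
     entries of the differentials have no constant term *)
  res_minimal : forall j l l', (res_diff j l l')@_0%MM = 0
}.

Definition res_shifts (F : min_graded_resolution) (j : nat) (s : int) : Prop :=
  exists l : 'I_(free_rank (res_rank F) j), res_shift l = s.

End Resolution.

Definition repunit_shifts (b n a j : nat) (s : int) : Prop :=
  exists (k : nat) (i : j.+1.-tuple nat),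
    [/\ (1 <= k <= j)%N,
        path ltn 1%N i,  (* 1 < i_1 < ... < i_(j+1) *)
        all (fun x => x <= n.+1)%N i
      & s = k%:Z * repunit_c b n a
            + (\sum_(x <- i) repunit_ext b n a x)%N%:Z].

(* Main.v *)
Require Import Defs.
From mathcomp Require Import all_boot all_order all_algebra.
From mathcomp Require Import mpoly.
From mathcomp Require Import zify ring.

(* The number of generators of [F_j] of degree [s] is the dimension of
   [Tor_j(k, k[S])_s], hence, by the Koszul complex, of the reduced homology in
   degree [j - 1] of the simplicial complex of the sets [T] of variables with
   [s - sum_(t in T) a_t] in [S].  Every element of [S] has a unique standard
   monomial, divisible by no [x_i x_l^b] with [2 <= i <= l <= n]; it is the
   factorization on which a suitable linear weight is maximal.  Reading a face
   [T] together with the standard monomial of [s - sum_(t in T) a_t] gives an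
   acyclic matching whose unmatched faces of size [j] inject into the pairs
   (k, i_1 < ... < i_(j+1)) with k c + a_(i_1) + ... + a_(i_(j+1)) = s, so the
   number of these pairs bounds the number of generators of degree [s].  There
   are j * 'C(n, j+1) pairs in total, which is the rank of [F_j]: all the bounds
   are equalities. *)

Set Implicit Arguments.
Unset Strict Implicit.
Unset Printing Implicit Defensive.

Import Order.TTheory GRing.Theory Num.Theory.

Local Open Scope ring_scope.

(** * The Koszul complex *)

(** The equalities [b * a_i = a_(i+1) + c] ([repunit_ext_step]) make the 2 x n matrix with rows
    [x_1^b, ..., x_n^b] and [x_2, ..., x_n, x_1^(a+1)] homogeneous: its rows differ by the degree
    [c]. Its 2 x 2 minors supply the rewriting of monomials, and the pairs index a basis of its
    Eagon-Northcott complex: [j + 1] columns and one of [j] values of [k]. That complex itself is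
    never built. Since the ranks are prescribed, one-sided bounds suffice: the generators of [F_j]
    need only inject into homology, and the matching need only bound homology, so no Morse
    differential is computed. As [F] is an arbitrary minimal resolution, the injection is made by
    hand, pushing generators through the double complex of [F] and the Koszul complex with an
    explicit contraction. The delicate point is acyclicity: the weight has to drop strictly from one
    matched face to the next, and the pivot rule is what excludes ties. *)

Section Koszul.

Variables (R : comNzRingType) (n : nat) (x : 'I_n -> R) (V : lmodType R).
Implicit Types (t u : 'I_n) (S T : {set 'I_n}) (z : {set 'I_n} -> V).

Definition ksign t T : R := (-1) ^+ #|[set u in T | u < t]|%N.

(** A chain is given by its coefficients, so the differential is read at [T] as a sum over the
    cofaces [t |: T]. Values in a module cover row vectors over [k[x]], that is, a free module
    tensored with the Koszul complex. *)
Definition koszul z T : V :=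
  \sum_(t | t \notin T) (ksign t T * x t) *: z (t |: T).

Lemma ksignU t u T : u \notin T ->
  ksign t (u |: T) = (-1) ^+ (u < t)%N * ksign t T.
Proof.
move=> uT; rewrite /ksign -exprD; congr (_ ^+ _).
have [ut|tu] := boolP (u < t)%N.
  have -> : [set v in u |: T | (v < t)%N] = u |: [set v in T | (v < t)%N].
    by apply/setP=> v; rewrite !inE; case: eqP => // ->; rewrite ut.
  by rewrite cardsU1 !inE (negbTE uT).
rewrite add0n; apply: eq_card => v; rewrite !inE.
by case: eqP => // ->; rewrite (negbTE tu) !andbF.
Qed.

Lemma eq_koszul z z' : z =1 z' -> forall T, koszul z T = koszul z' T.
Proof. by move=> e T; apply: eq_bigr => t _; rewrite e. Qed.

Lemma koszulD z z' T : koszul (fun S => z S + z' S) T = koszul z T + koszul z' T.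
Proof. by rewrite -big_split; apply: eq_bigr => t _; rewrite scalerDr. Qed.

(** The ordered pairs added to [T] are split according to which index is smaller; exchanging the two
    indices carries one half onto the other with the opposite sign. *)
Lemma koszul_koszul z T : koszul (koszul z) T = 0.
Proof.
rewrite /koszul; under eq_bigr do rewrite scaler_sumr.
pose G t u : V := (ksign t T * x t) *: ((ksign u (t |: T) * x u) *: z (u |: (t |: T))).
rewrite (eq_bigr (fun t => \sum_(u | (u \notin T) && (u < t)%N) G t u +
                           \sum_(u | (u \notin T) && (t < u)%N) G t u)); last first.
  move=> t tT; rewrite (bigID (fun u => u < t)%N) /=; congr (_ + _).
    apply: eq_bigl => u; rewrite !inE negb_or -andbA.
    by case: eqP => [->|] //=; rewrite ltnn !andbF.
  apply: eq_bigl => u; rewrite !inE negb_or.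
  case: (ltngtP u t) => [||/val_inj ->]; rewrite ?andbF ?andbT ?eqxx //=.
  by rewrite neq_ltn => ->; rewrite orbT.
rewrite big_split /= (exchange_big_dep (fun t => t \notin T)) /=; last first.
  by move=> t u _ /andP[].
rewrite -big_split big1 //= => u uT.
rewrite (eq_bigl (fun t => (t \notin T) && (u < t)%N)); last first.
  by move=> t; rewrite uT.
rewrite -big_split big1 //= => t /andP[tT ut].
rewrite /G !ksignU // ut (ltnNge t u) ltnW //= setUCA expr1 expr0 !scalerA.
rewrite -scalerDl -[RHS](scale0r (z (t |: (u |: T)))); congr (_ *: _); ring.
Qed.

End Koszul.

(** Serves twice: with the variables over [k[x]], and with all [x t = 1] over [k], where it is the
    simplicial boundary. *)
Definition koszulR (R : comNzRingType) (n : nat) (x : 'I_n -> R)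
  (f : {set 'I_n} -> R) (T : {set 'I_n}) : R :=
  \sum_(t | t \notin T) ksign R t T * x t * f (t |: T).

Lemma eq_koszulR (R : comNzRingType) (n : nat) (x : 'I_n -> R) f g :
  f =1 g -> forall T, koszulR x f T = koszulR x g T.
Proof. by move=> e T; apply: eq_bigr => t _; rewrite e. Qed.

Lemma koszulR_koszulR (R : comNzRingType) (n : nat) (x : 'I_n -> R) f T :
  koszulR x (koszulR x f) T = 0.
Proof. exact: (@koszul_koszul R n x R^o f T). Qed.

Lemma koszul_entry (R : comNzRingType) (n r : nat) (x : 'I_n -> R)
  (z : {set 'I_n} -> 'rV[R]_r) T i l :
  koszul x z T i l = koszulR x (fun S => z S i l) T.
Proof. by rewrite summxE; apply: eq_bigr => t _; rewrite mxE. Qed.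

Lemma koszul_mulmx (R : comNzRingType) (n r q : nat) (x : 'I_n -> R)
  (z : {set 'I_n} -> 'rV[R]_r) (A : 'M[R]_(r, q)) T :
  koszul x (fun S => z S *m A) T = koszul x z T *m A.
Proof.
by rewrite mulmx_suml; apply: eq_bigr => t _; rewrite -scalemxAl.
Qed.

(** * An explicit contraction of the Koszul complex of the variables *)

Section KoszulContraction.

Variables (k : fieldType) (n : nat).
Local Notation kx := {mpoly k[n]}.
Local Notation X := (fun i : 'I_n => 'X_i : kx).
Implicit Types (t u i : 'I_n) (T : {set 'I_n}) (p q : kx) (m : 'X_{1..n}).

Definition zero_below i m := [forall u : 'I_n, (u < i)%N ==> (m u == 0%N)].

Definition divX i p : kx :=
  \sum_(m <- msupp p | (0 < m i)%N && zero_below i m) p@_m *: 'X_[m - U_(i)].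

Lemma mcoeff_divX i p m :
  (divX i p)@_m = if zero_below i m then p@_(m + U_(i)) else 0.
Proof.
have zbU m' : zero_below i (m' + U_(i)) = zero_below i m'.
  apply: eq_forallb => u; rewrite mnmDE mnm1E.
  by case: (eqVneq i u) => [->|_]; rewrite ?ltnn ?addn0.
rewrite raddf_sum /= big_mkcond /=.
have [mi|mi] := boolP (m + U_(i) \in msupp p)%MM; last first.
  rewrite [p@_(_ + _)]memN_msupp_eq0 // if_same big1_seq // => m' /= m'p.
  case: ifP => // /andP[m'i m'z]; rewrite mcoeffZ mcoeffX.
  case: eqP; rewrite ?mulr0 // => e; case/negP: mi; rewrite -e submK //.
  by apply/mnm_lepP=> u; rewrite mnm1E; case: eqP => [<-|].
rewrite (bigD1_seq _ mi (msupp_uniq p)) /= big1_seq ?addr0.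
  by rewrite mnmDE mnm1E eqxx addn1 /= zbU addmK mcoeffZ mcoeffX eqxx mulr1.
move=> m' /andP[m'm m'p]; case: ifP => // /andP[m'i m'z].
rewrite mcoeffZ mcoeffX; case: eqP; rewrite ?mulr0 // => e.
case/eqP: m'm; rewrite -e submK //.
by apply/mnm_lepP=> u; rewrite mnm1E; case: eqP => [<-|].
Qed.

Lemma divXD i p q : divX i (p + q) = divX i p + divX i q.
Proof.
apply/mpolyP=> m; rewrite mcoeffD !mcoeff_divX mcoeffD.
by case: ifP => // _; rewrite addr0.
Qed.

Lemma divX0 i : divX i 0 = 0.
Proof. by apply/mpolyP=> m; rewrite mcoeff_divX !mcoeff0 if_same. Qed.

Lemma divXZ i c p : divX i (c *: p) = c *: divX i p.
Proof.
apply/mpolyP=> m; rewrite mcoeffZ !mcoeff_divX mcoeffZ.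
by case: ifP => // _; rewrite mulr0.
Qed.

Definition is_min i T := (i \in T) && [forall u in T, (i <= u)%N].

Lemma is_min_inj i u T : is_min i T -> is_min u T -> i = u.
Proof.
move=> /andP[iT /forall_inP iP] /andP[uT /forall_inP uP].
by apply: val_inj; apply/eqP; rewrite eqn_leq iP ?uP.
Qed.

(** The homotopy sending [x^m e_S] to [(x^m / x_i) e_(i |: S)] if the least index [i] occurring in
    [m] or [S] is not in [S], and to 0 otherwise. It is linear over [k] only. *)
Definition contract (z : {set 'I_n} -> kx) T : kx :=
  if [pick i | is_min i T] is Some i then divX i (z (T :\ i)) else 0.

Lemma contractE z T i : is_min i T -> contract z T = divX i (z (T :\ i)).
Proof.
rewrite /contract => iT; case: pickP => [u uT|/(_ i)]; last by rewrite iT.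
by rewrite (is_min_inj uT iT).
Qed.

Lemma mcoeffXM i p m :
  ('X_i * p)@_m = if (0 < m i)%N then p@_(m - U_(i)) else 0.
Proof.
rewrite mulrC; case: ifP => mi.
  have {1}-> : m = (U_(i) + (m - U_(i)))%MM.
    by rewrite addmC submK //; apply/mnm_lepP=> u; rewrite mnm1E; case: eqP => [<-|].
  by rewrite mcoeffMX.
apply: memN_msupp_eq0; rewrite (perm_mem (msuppMX _ _)).
apply/mapP=> [[m' _ e]]; by move: mi; rewrite e mnmDE mnm1E eqxx add1n.
Qed.

Lemma mcoeff_koszul (z : {set 'I_n} -> kx) T m :
  (koszulR X z T)@_m =
  \sum_(t | (t \notin T) && (0 < m t)%N)
    (-1) ^+ #|[set u in T | u < t]|%N * (z (t |: T))@_(m - U_(t)).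
Proof.
rewrite raddf_sum big_mkcondr /=; apply: eq_bigr => t tT.
rewrite -mulrA /ksign.
rewrite -signr_odd mulr_sign -signr_odd mulr_sign.
case: odd; rewrite ?mcoeffN mcoeffXM; case: ifP; rewrite ?oppr0 //.
Qed.

(** Compare the coefficients of [x^m e_T], with [i] the least index occurring in [m] or [T]. If [i]
    is in [T], the cycle equation at [T :\ i] and [x^m x_i] is the identity wanted; otherwise only
    the term [t = i] survives. If there is no index at all, what is left is the constant at [set0],
    the only homology of the Koszul complex. *)
Lemma koszul_contract (z : {set 'I_n} -> kx) :
  (forall T, koszulR X z T = 0) ->
  (z set0)@_0%MM = 0 ->
  forall T, koszulR X (contract z) T = z T.
Proof.
move=> zK z0 T; apply/mpolyP=> m; rewrite mcoeff_koszul.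
pose A := T :|: [set i | 0 < m i]%N.
have [i imin|noi] := pickP (fun i => is_min i A); last first.
  have A0 : A = set0.
    apply/eqP; apply/set0Pn => [[i0 i0A]].
    case: (@arg_minnP _ i0 (mem A) (@nat_of_ord n) i0A) => i iA iP.
    by have /negP[] := negbT (noi i); apply/andP; split=> //; apply/forall_inP.
  have T0 : T = set0.
    by apply/eqP; rewrite -subset0 -A0 subsetUl.
  have m0 : m = 0%MM.
    apply/mnmP=> i; rewrite mnm0E; have : i \notin A by rewrite A0 inE.
    by rewrite !inE negb_or lt0n negbK => /andP[_ /eqP].
  by rewrite m0 T0 z0 big1 // => t; rewrite mnm0E ltnn andbF.
have/andP[iA /forall_inP iP] := imin.
have mlt u : (u < i)%N -> m u = 0%N.
  move=> ui; apply/eqP; rewrite -leqn0 leqNgt; apply/negP=> mu.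
  by have := iP u; rewrite !inE mu orbT leqNgt ui => /(_ isT).
have Tge u : u \in T -> (i <= u)%N by move=> uT; apply: iP; rewrite inE uT.
have [iT|iT] := boolP (i \in T).
  have iminT t : t \notin T -> (0 < m t)%N -> is_min i (t |: T).
    move=> tT mt; rewrite /is_min !inE iT orbT; apply/forall_inP=> u.
    by rewrite !inE => /predU1P[->|/Tge //]; apply: iP; rewrite !inE mt orbT.
  have /(congr1 (mcoeff (m + U_(i))%MM)) := zK (T :\ i).
  rewrite mcoeff0 mcoeff_koszul (bigD1 i) /=; last first.
    by rewrite !inE eqxx mnmDE mnm1E eqxx addn1.
  rewrite setD1K // addmK.
  have -> : [set u in T :\ i | (u < i)%N] = set0.
    apply/setP=> u; rewrite !inE; case: eqP => //= _.
    by apply/negP=> /andP[/Tge]; rewrite leqNgt => /negP.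
  rewrite cards0 expr0 mul1r => /eqP; rewrite addr_eq0 => /eqP ->.
  rewrite -sumrN; apply: eq_big => [t|t /andP[tT mt]].
    rewrite !inE mnmDE mnm1E; case: (eqVneq t i) => [->|ti] /=.
      by rewrite iT /= andbF.
    by rewrite addn0 andbT.
  have ti : t != i by apply: contraNneq tT => ->.
  have it : (i < t)%N.
    by rewrite ltn_neqAle eq_sym (inj_eq val_inj) ti iP // !inE mt orbT.
  rewrite (contractE _ (iminT t tT mt)) mcoeff_divX.
  have -> : zero_below i (m - U_(t)).
    by apply/forall_inP=> u /mlt mu; rewrite mnmBE mu sub0n.
  have -> : (t |: T) :\ i = t |: (T :\ i).
    apply/setP=> u; rewrite !inE.
    by case: eqP => [->|]; rewrite ?andbT ?andbF //= eq_sym (negbTE ti).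
  have -> : (m - U_(t) + U_(i) = m + U_(i) - U_(t))%MM.
    apply/mnmP=> u; rewrite !(mnmBE, mnmDE, mnm1E).
    by case: (eqVneq t u) => [<-|_]; [lia | rewrite !subn0].
  have -> : [set u in T | (u < t)%N] = i |: [set u in T :\ i | (u < t)%N].
    by apply/setP=> u; rewrite !inE; case: eqP => [->|] //=; rewrite iT it.
  by rewrite cardsU1 !inE eqxx /= add1n exprS mulN1r mulNr.
have mi : (0 < m i)%N by move: iA; rewrite !inE (negbTE iT).
rewrite (bigD1 i) /= ?iT ?mi // big1 => [|t /andP[/andP[tT mt] ti]].
  have -> : [set u in T | (u < i)%N] = set0.
    apply/setP=> u; rewrite !inE.
    by apply/negP=> /andP[/Tge]; rewrite leqNgt => /negP.
  have imin' : is_min i (i |: T).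
    rewrite /is_min !inE eqxx; apply/forall_inP=> u.
    by rewrite !inE => /predU1P[->|/Tge].
  rewrite cards0 expr0 mul1r addr0 (contractE _ imin') mcoeff_divX setU1K //.
  have -> : zero_below i (m - U_(i)).
    by apply/forall_inP=> u /mlt mu; rewrite mnmBE mu sub0n.
  by rewrite submK //; apply/mnm_lepP=> u; rewrite mnm1E; case: eqP => [<-|].
have it : (i < t)%N.
  by rewrite ltn_neqAle eq_sym (inj_eq val_inj) ti iP // !inE mt orbT.
rewrite /contract; case: pickP => [u /andP[uT _]|_]; last by rewrite mcoeff0 mulr0.
rewrite mcoeff_divX ifF ?mulr0 //.
(* The monomial still contains [x_i], and [i] is smaller than the least index [u] of [t |: T], so
   [divX] discards it. *)
apply/negbTE; rewrite negb_forall; apply/existsP; exists i.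
have iu : (i < u)%N.
  move: uT; rewrite !inE => /predU1P[->//|uT].
  rewrite ltn_neqAle Tge // andbT (inj_eq val_inj).
  by apply: contraNneq iT => ->.
rewrite negb_imply iu mnmBE mnm1E (negbTE ti) subn0 /=.
by rewrite -lt0n.
Qed.

End KoszulContraction.

(** * From a free resolution to simplicial homology *)

Section Homogeneous.

Variables (k : fieldType) (n : nat) (w : 'I_n -> nat).
Local Notation kx := {mpoly k[n]}.
Implicit Types (p q : kx) (m : 'X_{1..n}) (T : {set 'I_n}) (s : int).

Definition set_weight T : nat := (\sum_(t in T) w t)%N.

Lemma set_weightU t T : t \notin T ->
  set_weight (t |: T) = (w t + set_weight T)%N.
Proof. exact: big_setU1. Qed.

Lemma set_weightD1 t T : t \in T -> set_weight T = (w t + set_weight (T :\ t))%N.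
Proof. exact: big_setD1. Qed.

Lemma wdegD m m' : wdeg w (m + m') = (wdeg w m + wdeg w m')%N.
Proof. by rewrite -big_split; apply: eq_bigr => i _; rewrite mnmDE mulnDl. Qed.

Lemma wdegU i : wdeg w U_(i) = w i.
Proof.
rewrite /wdeg (bigD1 i) //= mnm1E eqxx mul1n big1 ?addn0 // => j ji.
by rewrite mnm1E eq_sym (negbTE ji).
Qed.

Lemma whomog0 s : whomog w s (0 : kx).
Proof. by move=> m; rewrite msupp0. Qed.

Lemma whomogD s p q : whomog w s p -> whomog w s q -> whomog w s (p + q).
Proof.
move=> hp hq m /msuppD_le; rewrite mem_cat => /orP[]; [exact: hp|exact: hq].
Qed.

Lemma whomogM s s' p q : whomog w s p -> whomog w s' q -> whomog w (s + s') (p * q).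
Proof.
move=> hp hq m /msuppM_le /allpairsP[[m1 m2] /= [/hp <- /hq <- ->]].
by rewrite wdegD.
Qed.

Lemma whomogZ s c p : whomog w s p -> whomog w s (c *: p).
Proof. by move=> hp m /msuppZ_le /hp. Qed.

Lemma whomog_sum s (I : Type) (r : seq I) (P : pred I) (f : I -> kx) :
  (forall i, P i -> whomog w s (f i)) -> whomog w s (\sum_(i <- r | P i) f i).
Proof.
by move=> h; elim/big_rec: _ => [|i q /h hi hq]; [exact: whomog0|exact: whomogD].
Qed.

Lemma whomog_monomial s m c : (wdeg w m)%:Z = s -> whomog w s (c *: 'X_[m] : kx).
Proof. by move=> <- m' /msuppZ_le; rewrite msuppX inE => /eqP ->. Qed.

Lemma whomog_divX s i p : whomog w s p -> whomog w (s - (w i)%:Z) (divX i p).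
Proof.
move=> hp m; rewrite mcoeff_msupp mcoeff_divX; case: ifP; rewrite ?eqxx //.
move=> _; rewrite -mcoeff_msupp => /hp <-.
by rewrite wdegD wdegU PoszD addrK.
Qed.

Lemma semigroup_mapE p :
  semigroup_map w p = \sum_(m <- msupp p) (p@_m)%:P * 'X^(wdeg w m).
Proof.
rewrite /semigroup_map /mmap; apply: eq_bigr => m _; congr (_ * _).
rewrite /mmap1 /wdeg; elim/big_rec2: _ => [|i a c _ ->]; first by rewrite expr0.
by rewrite exprD mulnC exprM.
Qed.

Lemma horner1_semigroup_map p : (semigroup_map w p).[1] = p.@[fun=> 1].
Proof.
rewrite semigroup_mapE mevalE horner_sum; apply: eq_bigr => m _.
by rewrite hornerCM hornerXn expr1n big1 // => i _; rewrite expr1n.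
Qed.

(** All monomials of a homogeneous polynomial have the same image, so only the sum of the
    coefficients matters: evaluation at [(1, ..., 1)] identifies a nonzero graded component of
    [k[S]] with [k]. *)
Lemma whomog_semigroup_map s p :
  whomog w s p -> p.@[fun=> 1] = 0 -> semigroup_map w p = 0.
Proof.
move=> hp; rewrite mevalE => p0; rewrite semigroup_mapE.
under eq_bigr do rewrite mul_polyC.
rewrite big_seq (eq_bigr (fun m => p@_m *: 'X^`|s|%N)) => [|m /hp <- //].
rewrite -big_seq -scaler_suml.
rewrite (_ : \sum_(m <- msupp p) p@_m = 0) ?scale0r // -[RHS]p0.
by apply: eq_bigr => m _; rewrite big1 ?mulr1 // => i _; rewrite expr1n.
Qed.

Lemma whomog_meval_neq0 s p :
  whomog w s p -> p.@[fun=> 1] != 0 -> exists m, (wdeg w m)%:Z = s.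
Proof.
move=> hp p1; have: msupp p != [::].
  by apply: contraNneq p1 => /eqP; rewrite msupp_eq0 => /eqP ->; rewrite meval0.
move: hp; rewrite /whomog; case: (msupp p) => // m r h _.
by exists m; apply: h; rewrite mem_head.
Qed.

End Homogeneous.

(** * Sending generators of a minimal resolution to simplicial cycles *)

Section Descent.

Variables (k : fieldType) (n : nat) (w : 'I_n -> nat).
Variable F : min_graded_resolution k w.
Local Notation kx := {mpoly k[n]}.
Local Notation rk := (free_rank (res_rank F)).
Local Notation d := (res_diff F).
Local Notation X := (fun i : 'I_n => 'X_i : kx).
Local Notation cochain p := ({set 'I_n} -> 'rV[kx]_(rk p)).
Implicit Types (S T : {set 'I_n}) (s : int).

Definition zigzag_step p (z : cochain p.+1) : cochain p := fun T =>
  \row_l contract (fun S => (z S *m d p) 0 l) T.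

(* The zigzag in the double complex [F (x) Koszul] from [F_p (x) K] down to
   [F_0 (x) K]. *)
Fixpoint zigzag p : cochain p -> cochain 0 :=
  match p with
  | 0 => id
  | q.+1 => fun z => zigzag (zigzag_step z)
  end.

Lemma koszul_step p (z : cochain p.+1) :
  (forall T, koszul X z T *m d p = 0) ->
  (forall l, ((z set0 *m d p) 0 l)@_0%MM = 0) ->
  forall T, koszul X (zigzag_step z) T = z T *m d p.
Proof.
move=> zK z0 T; apply/rowP=> l; rewrite koszul_entry.
rewrite -(koszul_contract (z := fun S => (z S *m d p) 0 l)) //.
  by apply: eq_koszulR => S; rewrite mxE.
move=> S; rewrite -(koszul_entry _ (fun S => z S *m d p)).
by rewrite koszul_mulmx zK mxE.
Qed.

Lemma diff_diff p (v : 'rV_(rk p.+2)) : v *m d p.+1 *m d p = 0.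
Proof. by apply: (proj2 (res_exact (m := F) (v *m d p.+1))); exists v. Qed.

Lemma diff_aug (v : 'rV_(rk 1)) l : semigroup_map w ((v *m d 0) 0 l) = 0.
Proof.
apply: (proj2 (res_exact0 F _)); exists v; apply/rowP=> j.
by rewrite [RHS]mxE (ord1 l) (ord1 j).
Qed.

Definition mcoeff0_free p (v : 'rV[kx]_(rk p)) := forall l, (v 0 l)@_0%MM = 0.

(** The only form in which minimality is used: it makes the contraction applicable at [set0], and at
    the end it keeps a combination of generators from being a boundary. *)
Lemma diff_mcoeff0 p (v : 'rV_(rk p.+1)) : mcoeff0_free (v *m d p).
Proof.
move=> l; rewrite mxE raddf_sum big1 //= => i _.
by rewrite rmorphM /= res_minimal mulr0.
Qed.

(** One component of a boundary of the total complex; the usual signs are absorbed in [g] and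
    [u]. *)
Definition total_boundary p (z : cochain p) :=
  exists (g : cochain p) (u : cochain p.+1),
    forall T, z T = koszul X g T + u T *m d p.

Lemma zigzag_cycle p (z : cochain p.+1) :
  (forall T, koszul X z T *m d p = 0) ->
  forall T l, semigroup_map w (koszul X (zigzag z) T 0 l) = 0.
Proof.
elim: p z => [|p IHp] z zK T l.
  have -> : zigzag z = zigzag_step z by [].
  by rewrite koszul_step //; [exact: diff_aug|exact: diff_mcoeff0].
apply: IHp => S; rewrite koszul_step //; first exact: diff_diff.
exact: diff_mcoeff0.
Qed.

(** Applying [koszul] to the expression of [zigzag_step z] shows that [z] and [koszul X u] have the
    same image under [d p]. By exactness of [F] they differ by an image of [d p.+1], so the old [u]
    becomes the new [g]. *)
Lemma total_boundary_step p (z : cochain p.+1) :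
  (forall T, koszul X z T *m d p = 0) ->
  total_boundary (zigzag_step z) -> total_boundary z.
Proof.
move=> zK [g [u zE]].
have /fin_all_exists [v vE] T :
    exists v, v *m d p.+1 = z T - koszul X u T.
  apply/(res_exact (m := F)); rewrite mulmxBl -koszul_step //; last exact: diff_mcoeff0.
  by rewrite (eq_koszul X zE) koszulD koszul_koszul add0r koszul_mulmx subrr.
by exists u, v => T; rewrite vE addrC subrK.
Qed.

(** The dependent match is there because [F_0] has no outgoing differential in the complex: for
    [p = 0] no cycle condition can be stated, and the zigzag is the identity. *)
Lemma total_boundary_zigzag p (z : cochain p) :
  (if p is q.+1 return cochain p -> Prop
   then fun z => forall T, koszul X z T *m d q = 0 else fun=> True) z ->
  total_boundary (zigzag z) -> total_boundary z.
Proof.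
elim: p z => [|p IHp] // z zK /IHp zb.
apply: total_boundary_step => //; apply: zb.
case: p z zK {IHp} => // p z zK T; rewrite koszul_step //; first exact: diff_diff.
exact: diff_mcoeff0.
Qed.

Definition chomog p s (z : cochain p) := forall T l,
  whomog w (s - (set_weight w T)%:Z - res_shift l) (z T 0 l).

Definition csupp p q (z : cochain p) := forall T, #|T| != q -> z T = 0.

Lemma chomog_step p s (z : cochain p.+1) : chomog s z -> chomog s (zigzag_step z).
Proof.
move=> zh T l; rewrite mxE /contract.
case: pickP => [i /andP[iT _]|_]; last exact: whomog0.
rewrite (set_weightD1 w iT) PoszD.
have -> : s - ((w i)%:Z + (set_weight w (T :\ i))%:Z) - res_shift l =
          (s - (set_weight w (T :\ i))%:Z - res_shift l) - (w i)%:Z by ring.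
apply: whomog_divX; rewrite mxE; apply: whomog_sum => l' _.
have -> : s - (set_weight w (T :\ i))%:Z - res_shift l =
  (s - (set_weight w (T :\ i))%:Z - res_shift l') + (res_shift l' - res_shift l) by ring.
apply: whomogM; [exact: zh|exact: res_homog].
Qed.

Lemma csupp_step p q (z : cochain p.+1) : csupp q z -> csupp q.+1 (zigzag_step z).
Proof.
move=> zq T Tq; apply/rowP=> l; rewrite !mxE /contract.
case: pickP => [i /andP[iT _]|//].
rewrite zq ?mul0mx ?mxE ?divX0 //.
by apply: contraNneq Tq => <-; rewrite (cardsD1 i) iT.
Qed.

Lemma chomog_zigzag p s (z : cochain p) : chomog s z -> chomog s (zigzag z).
Proof. by elim: p z => // p IHp z /chomog_step /IHp. Qed.

Lemma csupp_zigzag p q (z : cochain p) : csupp q z -> csupp (q + p)%N (zigzag z).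
Proof.
elim: p q z => [|p IHp] q z zq; first by rewrite addn0.
by rewrite addnS -addSn; apply/IHp/csupp_step.
Qed.

Lemma contractP c (f g : {set 'I_n} -> kx) T :
  contract (fun S => c *: f S + g S) T = c *: contract f T + contract g T.
Proof.
rewrite /contract; case: pickP => [i _|_]; last by rewrite scaler0 addr0.
by rewrite divXD divXZ.
Qed.

Lemma eq_contract (f g : {set 'I_n} -> kx) : f =1 g -> contract f =1 contract g.
Proof. by move=> e T; rewrite /contract; case: pickP => // i _; rewrite e. Qed.

Lemma eq_zigzag p (z z' : cochain p) : z =1 z' -> zigzag z =1 zigzag z'.
Proof.
elim: p z z' => // p IHp z z' e; apply: IHp => T.
by apply/rowP=> l; rewrite !mxE; apply: eq_contract => S; rewrite e.
Qed.

Lemma zigzagP p c (z z' : cochain p) T :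
  zigzag (fun S => c%:MP *: z S + z' S) T = c%:MP *: zigzag z T + zigzag z' T.
Proof.
elim: p z z' => // p IHp z z' /=; rewrite -IHp; apply: eq_zigzag => S.
apply/rowP=> l; rewrite !mxE mul_mpolyC -contractP; apply: eq_contract => S'.
by rewrite mulmxDl -scalemxAl !mxE mul_mpolyC.
Qed.

Lemma zigzag0 p T : zigzag (fun _ => 0 : 'rV_(rk p)) T = 0.
Proof.
elim: p => //= p IHp; rewrite -[RHS]IHp; apply: eq_zigzag => S.
apply/rowP=> l; rewrite [LHS]mxE [RHS]mxE /contract; case: pickP => // i _.
by rewrite mul0mx mxE divX0.
Qed.

Lemma zigzag_sum p (I : finType) (c : I -> k) (z : I -> cochain p) T :
  zigzag (fun S => \sum_i (c i)%:MP *: z i S) T =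
  \sum_i (c i)%:MP *: zigzag (z i) T.
Proof.
pose f r S := \sum_(i <- r) (c i)%:MP *: z i S.
suff H r : zigzag (f r) T = \sum_(i <- r) (c i)%:MP *: zigzag (z i) T by exact: H.
elim: r => [|i r IHr].
  rewrite big_nil -[RHS](zigzag0 p T); apply: eq_zigzag => S.
  by rewrite /f big_nil.
rewrite big_cons -IHr -zigzagP; apply: eq_zigzag => S.
by rewrite /f big_cons.
Qed.

Definition generator p (l : 'I_(rk p)) : cochain p :=
  fun T => if T == set0 then delta_mx 0 l else 0.

Lemma koszul_generator p (l : 'I_(rk p)) T : koszul X (generator l) T = 0.
Proof.
apply: big1 => t _; rewrite /generator ifN ?scaler0 //.
by apply/set0Pn; exists t; rewrite setU11.
Qed.

Lemma chomog_generator p (l : 'I_(rk p)) : chomog (res_shift l) (generator l).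
Proof.
move=> T l'; rewrite /generator; case: eqP => [->|_]; last by rewrite mxE; exact: whomog0.
rewrite mxE eqxx /=; case: eqP => [->|_]; last exact: whomog0.
rewrite /set_weight big_set0 subr0 subrr => m.
by rewrite msupp1 inE => /eqP ->; rewrite /wdeg big1 // => i _; rewrite mnm0E.
Qed.

Lemma csupp_generator p (l : 'I_(rk p)) : csupp 0 (generator l).
Proof. by move=> T; rewrite /generator cards_eq0 => /negbTE ->. Qed.

Definition simplicial_boundary (f : {set 'I_n} -> k) :=
  koszulR (fun _ => 1) f.

(** The zigzag of a generator ends in [F_0 (x) K_p], with a coefficient at [T] homogeneous of degree
    [res_shift l - set_weight w T]. Its image in that component of [k[S]], of dimension at most one,
    is recorded by its value at [(1, ..., 1)]. *)
Definition tor_cycle p (l : 'I_(rk p)) T : k :=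
  (zigzag (generator l) T 0 0).@[fun=> 1].

Definition in_complex s T := exists m, (wdeg w m + set_weight w T)%N%:Z = s.

Lemma meval_koszul (f : {set 'I_n} -> kx) T :
  (koszulR X f T).@[fun=> 1] =
  simplicial_boundary (fun S => (f S).@[fun=> 1]) T.
Proof.
rewrite raddf_sum; apply: eq_bigr => t _ /=.
by rewrite /ksign !rmorphM /= mevalXU !mulr1 rmorphXn /= rmorphN1.
Qed.

Lemma tor_cycle_boundary p (l : 'I_(rk p.+1)) T :
  simplicial_boundary (tor_cycle l) T = 0.
Proof.
rewrite /tor_cycle -meval_koszul -koszul_entry -(horner1_semigroup_map w).
by rewrite zigzag_cycle ?horner0 // => S; rewrite koszul_generator mul0mx.
Qed.

Lemma tor_cycle_supp p (l : 'I_(rk p)) T :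
  tor_cycle l T != 0 -> #|T| = p /\ in_complex (res_shift l) T.
Proof.
move=> lT; split.
  apply: contraNeq lT => Tp; rewrite /tor_cycle (csupp_zigzag (csupp_generator l)) //.
  by rewrite mxE meval0.
have := chomog_zigzag (@chomog_generator p l) (T := T) (l := 0).
move/whomog_meval_neq0 => /(_ lT)[m mE]; exists m.
by rewrite PoszD mE res_shift0 subr0 subrK.
Qed.

(** The injectivity into homology. A bounding chain [g] lifts to monomial coefficients [h]; the
    zigzag of the combination [z] then differs from the Koszul boundary of [h] by a kernel element
    of [semigroup_map], hence is a total boundary, and so is [z]. At [set0], Koszul boundaries and
    images of [d] have no constant terms, while those of [z] are the [c l]. *)
Lemma tor_cycle_indep p s (c : 'I_(rk p.+1) -> k) (g : {set 'I_n} -> k) :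
  (forall l, c l != 0 -> res_shift l = s) ->
  (forall T, g T != 0 -> in_complex s T) ->
  (forall T, \sum_l c l * tor_cycle l T = simplicial_boundary g T) ->
  forall l, c l = 0.
Proof.
move=> cs gs cg.
pose z S := \sum_l (c l)%:MP *: generator l S.
have zE T : zigzag z T = \sum_l (c l)%:MP *: zigzag (generator l) T.
  exact: zigzag_sum.
have /fin_all_exists [e eE] T : exists e : 'X_{1..n},
    g T != 0 -> (wdeg w e + set_weight w T)%N%:Z = s.
  have [_|/gs[e eE]] := eqVneq (g T) 0; first by exists 0%MM.
  by exists e.
pose h T : kx := g T *: 'X_[e T].
have hh T : whomog w (s - (set_weight w T)%:Z) (h T).
  rewrite /h; have [->|gT] := eqVneq (g T) 0; first by rewrite scale0r; exact: whomog0.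
  by apply: whomog_monomial; rewrite -(eE _ gT) PoszD addrK.
have hT T : (h T).@[fun=> 1] = g T.
  by rewrite mevalZ mevalX big1 ?mulr1 // => i _; rewrite expr1n.
have zh : chomog s (zigzag z).
  apply: chomog_zigzag => T l; rewrite summxE; apply: whomog_sum => l' _.
  rewrite mxE mul_mpolyC.
  have [->|cl] := eqVneq (c l') 0; first by rewrite scale0r; exact: whomog0.
  by apply: whomogZ; rewrite -(cs _ cl); apply: chomog_generator.
have /fin_all_exists [u uE] T : exists u : 'rV_(rk 1),
    u *m d 0 = zigzag z T - const_mx (koszulR X h T).
  pose q := zigzag z T 0 0 - koszulR X h T.
  have : semigroup_map w q = 0.
    apply: (@whomog_semigroup_map _ _ _ (s - (set_weight w T)%:Z)).
      apply: whomogD; first by have := zh T 0; rewrite res_shift0 subr0.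
      rewrite -scaleN1r; apply: whomogZ; apply: whomog_sum => t tT.
      rewrite /ksign -signr_odd -mulrA mulr_sign.
      have ht : whomog w (s - (set_weight w T)%:Z) ('X_t * h (t |: T)).
        have -> : s - (set_weight w T)%:Z = (w t)%:Z + (s - (set_weight w (t |: T))%:Z).
          by rewrite set_weightU // PoszD; ring.
        apply: whomogM (hh _); rewrite -[X in whomog _ _ X]scale1r.
        by apply: whomog_monomial; rewrite wdegU.
      by case: odd => //; rewrite -scaleN1r; apply: whomogZ.
    rewrite mevalB meval_koszul zE summxE raddf_sum.
    rewrite (eq_bigr (fun l => c l * tor_cycle l T)) => [|l _]; last first.
      by rewrite mxE -[LHS]/(_.@[_]) mevalM mevalC.
    rewrite cg; apply/eqP; rewrite subr_eq0; apply/eqP.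
    by apply: eq_koszulR => S; rewrite hT.
  case/(res_exact0 F) => u uE; exists u; rewrite uE.
  by apply/rowP=> i; rewrite (ord1 i) !mxE.
have [g' [v zb]] : total_boundary z.
  apply: total_boundary_zigzag => [T|].
    rewrite -koszul_mulmx /koszul big1 // => t tT.
    rewrite /z big1 ?mul0mx ?scaler0 // => l _.
    rewrite /generator ifN ?scaler0 //.
    by apply/set0Pn; exists t; rewrite setU11.
  exists (fun S => const_mx (h S)), u => T; rewrite uE addrC -[LHS]addr0 -addrA.
  congr (_ + _); apply/rowP=> i; rewrite !mxE koszul_entry.
  apply/esym/eqP; rewrite addrC subr_eq0; apply/eqP.
  by apply: eq_koszulR => S; rewrite mxE.
move=> l; move/rowP: (zb set0) => /(_ l) /(congr1 (mcoeff 0%MM)).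
rewrite [in RHS]mxE mcoeffD diff_mcoeff0 addr0 !summxE !raddf_sum /= (bigD1 l) //=.
rewrite !big1 ?addr0 => [|t _|l' l'l].
- by rewrite /generator eqxx !mxE !eqxx mulr1 mcoeffC eqxx mulr1.
- by rewrite mxE -mulrA mulrCA mcoeffXM mnm0E.
by rewrite /generator eqxx !mxE eqxx /= eq_sym (negbTE l'l) mulr0 mcoeff0.
Qed.

End Descent.

(** * Homology and acyclic matchings *)

Lemma leq_card_indep (k : fieldType) (A B : finType) (M : A -> B -> k) :
  (forall c : A -> k, (forall y, \sum_x c x * M x y = 0) -> forall x, c x = 0) ->
  (#|A| <= #|B|)%N.
Proof.
move=> indep; pose N := \matrix_(i < #|A|, j < #|B|) M (enum_val i) (enum_val j).
have /eqP <- : row_free N.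
  apply/inj_row_free => v vN; apply/rowP=> i; rewrite mxE -(enum_valK i).
  apply: (indep (fun x => v 0 (enum_rank x))) => y.
  have /rowP/(_ (enum_rank y)) := vN; rewrite !mxE => e; rewrite -[RHS]e.
  rewrite (reindex _ (onW_bij _ (enum_val_bij A))) /=.
  by apply: eq_bigr => l _; rewrite enum_valK !mxE enum_rankK.
exact: rank_leq_col.
Qed.

Section Matching.

Variables (k : fieldType) (n : nat).
Implicit Types (S T : {set 'I_n}) (t : 'I_n) (f g : {set 'I_n} -> k).
Local Notation bd := (simplicial_boundary (k := k) (n := n)).

Lemma simplicial_boundaryP c f g T : bd (fun S => c * f S + g S) T = c * bd f T + bd g T.
Proof.
rewrite mulr_sumr -big_split; apply: eq_bigr => t _; rewrite mulrDr; congr (_ + _).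
by rewrite mulrCA.
Qed.

Lemma simplicial_boundary_sum (I : finType) (c : I -> k) (f : I -> {set 'I_n} -> k) T :
  bd (fun S => \sum_i c i * f i S) T = \sum_i c i * bd (f i) T.
Proof.
rewrite [LHS](eq_bigr (fun t => \sum_i c i * (ksign k t T * 1 * f i (t |: T)))).
  by rewrite exchange_big /=; apply: eq_bigr => i _; rewrite mulr_sumr.
by move=> t _; rewrite mulr_sumr; apply: eq_bigr => i _; rewrite mulrCA.
Qed.

Lemma simplicial_boundary_neq0 f T : bd f T != 0 ->
  exists2 t, t \notin T & f (t |: T) != 0.
Proof.
move=> fT; have [t /andP[tT ft]|no] := pickP (fun t => (t \notin T) && (f (t |: T) != 0)).
  by exists t.
case/eqP: fT; apply: big1 => t tT.
by have /negbT := no t; rewrite tT negbK => /eqP ->; rewrite mulr0.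
Qed.

(* [D] collects the faces matched with a face of one dimension less; the
   matching sends [T] to [T :\ piv T]. *)
Variables (Delta D : {set {set 'I_n}}) (piv : {set 'I_n} -> 'I_n).
Variable rank : {set 'I_n} -> nat.

Hypothesis Delta_face : forall T t, t \notin T -> t |: T \in Delta -> T \in Delta.
Hypothesis D_Delta : D \subset Delta.
Hypothesis piv_in : forall T, T \in D -> piv T \in T.
Hypothesis rank_lt : forall T t, T \in D -> t \notin T ->
  t |: (T :\ piv T) \in D -> (rank (t |: (T :\ piv T)) < rank T)%N.
Hypothesis D_disjoint : forall T, T \in D -> T :\ piv T \notin D.

(** Read the boundary at [T :\ piv T] for a face [T] of least rank in the support: every other
    coface in [D] has smaller rank, so only [f T] remains, up to sign. *)
Lemma boundary_inj_matched f :
  (forall T, f T != 0 -> T \in D) -> (forall T, bd f T = 0) -> forall T, f T = 0.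
Proof.
move=> fD bf T0; apply/eqP/negPn/negP=> fT0.
case: (@arg_minnP _ T0 (fun T => f T != 0) rank fT0) => T fT Tmin.
have TD := fD _ fT; have pT := piv_in TD.
case/eqP: fT; have /eqP := bf (T :\ piv T).
rewrite /simplicial_boundary /koszulR (bigD1 (piv T)) ?inE ?eqxx //= setD1K //.
rewrite big1 ?addr0 => [|t /andP[tT tp]].
  by rewrite mulr1 /ksign mulf_eq0 signr_eq0 => /eqP.
apply/eqP; rewrite mulf_eq0; apply/orP; right; apply/negPn/negP=> ft.
have tT' : t \notin T by move: tT; rewrite !inE tp.
by have := rank_lt TD tT' (fD _ ft); rewrite ltnNge Tmin.
Qed.

(** Two distinct faces matched with the same one would each have smaller rank than the other. *)
Lemma match_inj : {in D &, injective (fun T => T :\ piv T)}.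
Proof.
suff H T T' : T \in D -> T' \in D -> T :\ piv T = T' :\ piv T' ->
    T <> T' -> (rank T' < rank T)%N.
  move=> T T' TD T'D /= e; apply/eqP/negPn/negP=> /eqP ne.
  have := H _ _ TD T'D e ne; rewrite ltnNge ltnW //.
  by apply: H => // e'; apply: ne.
move=> TD T'D e ne; have T'E : T' = piv T' |: (T :\ piv T) by rewrite e setD1K ?piv_in.
have pT : piv T' \notin T.
  apply/negP=> p'T; case: ne; rewrite T'E; case: (eqVneq (piv T') (piv T)) => [->|pp].
    by rewrite setD1K ?piv_in.
  have : piv T' \in T' :\ piv T' by rewrite -e !inE pp.
  by rewrite !inE eqxx.
by rewrite {1}T'E; apply: rank_lt; rewrite -?T'E.
Qed.

Definition critical j : {set {set 'I_n}} :=
  [set T in Delta | [&& #|T| == j, T \notin D & T \notin [set S :\ piv S | S in D]]].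

(** Join to the cycles [phi] the boundaries of the faces of [D] of size [j + 1], all restricted to
    the faces of size [j] outside [D]. A combination vanishing there is a cycle supported on [D],
    hence zero, so these vectors are independent. In the resulting inequality the added boundaries
    are offset by the faces [S :\ piv S], and the critical ones remain. *)
Lemma leq_card_critical (L : finType) j (phi : L -> {set 'I_n} -> k) :
  (forall l T, bd (phi l) T = 0) ->
  (forall l T, phi l T != 0 -> T \in Delta /\ #|T| = j) ->
  (forall (c : L -> k) g, (forall T, g T != 0 -> T \in Delta) ->
     (forall T, \sum_l c l * phi l T = bd g T) -> forall l, c l = 0) ->
  (#|L| <= #|critical j|)%N.
Proof.
move=> phic phis phii.
pose Dj := [set T in D | #|T| == j.+1].
pose B := [set T in Delta | (#|T| == j) && (T \notin D)].
pose e (S : {set 'I_n}) T : k := (T == S)%:R.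
pose M (x : L + {T | T \in Dj}) (y : {T | T \in B}) : k :=
  match x with
  | inl l => phi l (val y)
  | inr U => bd (e (val U)) (val y)
  end.
have le1 : (#|{: L + {T | T \in Dj}}| <= #|{: {T | T \in B}}|)%N.
  apply: (@leq_card_indep k _ _ M) => c cM.
  pose g T := \sum_(S : {T | T \in Dj}) c (inr S) * e (val S) T.
  have gE (S : {T | T \in Dj}) : g (val S) = c (inr S).
    rewrite /g (bigD1 S) //= /e eqxx mulr1 big1 ?addr0 // => S' ne.
    by rewrite (inj_eq val_inj) eq_sym (negbTE ne) mulr0.
  have gDj T : g T != 0 -> T \in Dj.
    apply: contraR => TD; apply/eqP; apply: big1 => S _; rewrite /e.
    by case: eqP => [E|_]; rewrite ?mulr0 //; case/negP: TD; rewrite E (valP S).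
  have gD T : g T != 0 -> T \in D by move/gDj; rewrite inE => /andP[].
  pose f T := 1 * (\sum_l c (inl l) * phi l T) + bd g T.
  have sphi T : (\sum_l c (inl l) * phi l T) != 0 -> T \in Delta /\ #|T| = j.
    move=> s0; have [l ls|no] := pickP (fun l => phi l T != 0); first exact: phis ls.
    case/eqP: s0; apply: big1 => l _.
    by have /negbFE/eqP -> := no l; rewrite mulr0.
  have sg T : bd g T != 0 -> T \in Delta /\ #|T| = j.
    move=> /simplicial_boundary_neq0[t tT /gDj]; rewrite inE => /andP[tD].
    rewrite cardsU1 tT add1n eqSS => /eqP; split=> //.
    exact: Delta_face tT (subsetP D_Delta _ tD).
  have fD T : f T != 0 -> T \in D.
    move=> fT; have [TDel Tj] : T \in Delta /\ #|T| = j.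
      have [s0|/sphi //] := eqVneq (\sum_l c (inl l) * phi l T) 0.
      by apply: sg; move: fT; rewrite /f s0 mulr0 add0r.
    apply: contraR fT => TD; have TB : T \in B by rewrite inE TDel Tj eqxx.
    apply/eqP; have := cM (exist _ T TB); rewrite big_sumType /= => <-.
    by rewrite /f mul1r; congr (_ + _); rewrite /g simplicial_boundary_sum.
  have f0 : forall T, f T = 0.
    apply: boundary_inj_matched => // T; rewrite simplicial_boundaryP.
    rewrite simplicial_boundary_sum big1 ?mulr0 ?add0r => [|l _].
      exact: koszulR_koszulR.
    by rewrite phic mulr0.
  have c0 : forall l, c (inl l) = 0.
    apply: (phii (fun l => c (inl l)) (fun T => -1 * g T + 0)) => T.
      by rewrite addr0 mulN1r oppr_eq0 => /gD; apply: subsetP.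
    rewrite simplicial_boundaryP mulN1r.
    have -> : bd (fun=> 0) T = 0 by apply: big1 => t _; rewrite mulr0.
    by rewrite addr0; have /eqP := f0 T; rewrite /f mul1r addr_eq0 => /eqP ->.
  have g0 : forall T, g T = 0.
    apply: boundary_inj_matched => // T; have := f0 T.
    by rewrite /f big1 ?mulr0 ?add0r // => l _; rewrite c0 mul0r.
  by case=> [//|S]; rewrite -gE g0.
have UE : #|Dj| = #|[set T :\ piv T | T in Dj]|.
  rewrite card_in_imset // => T T'; rewrite !inE => /andP[TD _] /andP[T'D _].
  exact: match_inj.
have UB : [set T :\ piv T | T in Dj] \subset B.
  apply/subsetP=> _ /imsetP[T + ->]; rewrite !inE => /andP[TD /eqP Tj].
  have pT := piv_in TD.
  rewrite D_disjoint // (_ : #|T :\ piv T| == j) ?andbT; last first.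
    by rewrite -eqSS -Tj (cardsD1 (piv T) T) pT.
  apply: (@Delta_face _ (piv T)); first by rewrite !inE eqxx.
  by rewrite setD1K // (subsetP D_Delta).
have BE : B :\: [set T :\ piv T | T in Dj] \subset critical j.
  apply/subsetP=> T; rewrite !inE => /andP[TU /and3P[-> /eqP Tj -> /=]].
  rewrite Tj eqxx /=; apply: contra TU => /imsetP[S SD TE]; apply/imsetP.
  exists S => //; rewrite inE SD /= (cardsD1 (piv S)) piv_in // -TE Tj.
  by rewrite add1n.
apply: leq_trans (subset_leq_card BE).
rewrite cardsD (setIidPr UB) -UE leq_subRL; last by rewrite UE subset_leq_card.
by move: le1; rewrite card_sum !card_sig addnC.
Qed.

End Matching.

(** * Standard monomials *)

Definition repunit (b i : nat) : nat := (\sum_(0 <= l < i) b ^ l)%N.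

Lemma repunitS b i : repunit b i.+1 = (b * repunit b i + 1)%N.
Proof.
rewrite /repunit big_nat_recl // expn0 addnC big_distrr; congr (_ + _)%N.
by apply: eq_bigr => l _; rewrite expnS.
Qed.

Lemma repunitSr b i : repunit b i.+1 = (repunit b i + b ^ i)%N.
Proof. by rewrite /repunit big_nat_recr. Qed.

Lemma repunit_genE b n a i :
  repunit_gen b n a i.+1 = (repunit b n + a * repunit b i)%N.
Proof.
elim: i => [|i IHi]; first by rewrite /repunit (big_geq (leqnn 0)) muln0 addn0.
have -> : repunit_gen b n a i.+2 = (repunit_gen b n a i.+1 + a * b ^ i)%N by [].
by rewrite IHi repunitSr mulnDr addnA.
Qed.

(** The value [(a + 1) a_1] chosen for [a_(n+1)] is the one that continues this formula to [i = n],
    so the last column needs no separate treatment of degrees. *)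
Lemma repunit_extE b n a i :
  repunit_ext b n a i.+1 = (repunit b n + a * repunit b i)%N.
Proof.
rewrite /repunit_ext eqSS; case: eqP => [->|_]; last exact: repunit_genE.
by rewrite repunit_genE [repunit b 0]big_geq // muln0 addn0 mulSn.
Qed.

Lemma repunit_ext_step b n a i :
  (b * repunit_ext b n a i.+1)%N%:Z = (repunit_ext b n a i.+2)%:Z + repunit_c b n a.
Proof.
have := repunitS b n; rewrite repunitSr => e.
rewrite !repunit_extE repunitS /repunit_c.
by move: (repunit b n) (repunit b i) (b ^ n)%N e => x y z; lia.
Qed.

Section NormalForm.

Variables (b n0 a : nat).
Local Notation n := n0.+1.
Hypotheses (b_gt1 : (1 < b)%N).
Implicit Types (e f g m : 'X_{1..n}) (i j : 'I_n).
Local Notation w := (@repunit_weight b n a).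
Local Notation r := (repunit b).

Lemma repunit_weightE i : w i = repunit_ext b n a i.+1.
Proof. by rewrite /repunit_weight repunit_genE repunit_extE. Qed.

Lemma repunit_weight_gt0 i : (0 < w i)%N.
Proof. by rewrite repunit_weightE repunit_extE repunitS addn1 addSn. Qed.

(* Exponents of monomials divisible by no [x_i x_j^b], [2 <= i <= j <= n]
   (so [0 < i <= j] in 'I_n). *)
Definition standard e := [forall j : 'I_n, (0 < j)%N ==>
  (e j <= b)%N && ((e j == b) ==> [forall i : 'I_n, (0 < i < j)%N ==> (e i == 0%N)])].

Lemma standardP e : reflect
  (forall j, (0 < j)%N -> (e j <= b)%N /\
     (e j = b -> forall i, (0 < i < j)%N -> e i = 0%N)) (standard e).
Proof.
apply: (iffP forall_inP) => h j /h.
  move=> /andP[-> /implyP h']; split=> // /eqP /h' /forall_inP h'' i /h'' /eqP //.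
case=> -> h' /=; apply/implyP=> /eqP /h' h''.
by apply/forall_inP=> i /h'' ->.
Qed.

Lemma standard_divisor e f : standard (e + f) -> standard e.
Proof.
move=> /standardP ef; apply/standardP=> j j0; have [le z] := ef j j0.
rewrite !mnmDE in le z; split; first exact: leq_trans (leq_addr _ _) le.
move=> ej i ij; have /eqP : (e j + f j)%N = b.
  by apply/eqP; rewrite eqn_leq le -ej leq_addr.
by move=> /eqP /z /(_ i ij) /eqP; rewrite mnmDE addn_eq0 => /andP[/eqP].
Qed.

(* A weight that the rewriting [x_i x_j^b -> x_(i-1)^b x_(j+1)], with
   [x_(n+1) = x_1^(a+1)], increases. *)
Definition potential : 'I_n -> nat := fun i => (n0 - i)%N.

Lemma wdegMn (v : 'I_n -> nat) m c : wdeg v (m *+ c) = (c * wdeg v m)%N.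
Proof.
elim: c => [|c IHc]; last by rewrite mulmS wdegD IHc mulSn.
by rewrite mulm0n mul0n /wdeg big1 // => i _; rewrite mnm0E.
Qed.

(** The binomial is the minor on the columns headed by [x_(i-1)^b] and [x_j^b]. The weight grows by
    at least [(b - 1) * (j - i + 1)]. *)
Lemma rewrite_step i j : (0 < i <= j)%N -> exists m,
  wdeg w m = (w i + b * w j)%N /\
  (potential i + b * potential j < wdeg potential m)%N.
Proof.
move=> /andP[i0 ij].
pose p : 'I_n := inord i.-1.
have pE : i = p.+1 :> nat.
  by rewrite /p inordK ?prednK // ltnW // ltn_ord.
pose m : 'X_{1..n} := if (j.+1 < n)%N then U_(inord j.+1)%MM else (U_(ord0) *+ a.+1)%MM.
have mw : wdeg w m = repunit_ext b n a j.+2.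
  rewrite /m; case: ltnP => jn; first by rewrite wdegU repunit_weightE inordK.
  have -> : j.+2 = n.+1 by have := ltn_ord j; lia.
  by rewrite wdegMn wdegU repunit_weightE !repunit_extE [repunit b 0]big_geq //; ring.
exists (U_(p) *+ b + m)%MM; rewrite !wdegD !wdegMn !wdegU mw; split.
  apply/eqP; rewrite -eqz_nat !PoszD !repunit_weightE pE !repunit_ext_step.
  by apply/eqP; ring.
rewrite /potential.
(* For the last [j] the left side truncates to 0, so the weight of the power of [x_1] need not be
   computed. *)
have : (n0 - j.+1 <= wdeg potential m)%N.
  rewrite /m; case: ltnP => jn; first by rewrite wdegU /potential inordK.
  by rewrite (_ : n0 - j.+1 = 0)%N //; apply/eqP; rewrite subn_eq0 ltnW.
have := ltn_ord j; rewrite ltnS; move: pE ij.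
move: (wdeg _ m) (nat_of_ord i) (nat_of_ord j) (nat_of_ord p) => M i' j' p' -> ij jn.
have [y jE] : exists y, n0 = (j' + y)%N by exists (n0 - j')%N; lia.
have [x pE] : exists x, (j' = p' + x.+1)%N by exists (j' - p').-1; lia.
rewrite jE pE.
have -> : (p' + x.+1 + y - p'.+1 = x + y)%N by lia.
have -> : (p' + x.+1 + y - (p' + x.+1) = y)%N by lia.
have -> : (p' + x.+1 + y - p' = (x + y).+1)%N by lia.
have -> : (p' + x.+1 + y - (p' + x.+1).+1 = y.-1)%N by lia.
by nia.
Qed.

Lemma not_standard_improve e : ~~ standard e -> exists g,
  wdeg w g = wdeg w e /\ (wdeg potential e < wdeg potential g)%N.
Proof.
move=> eN; have [i [j [ij le]]] : exists i j, (0 < i <= j)%N /\ (U_(i) + U_(j) *+ b <= e)%MM.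
  move: eN; rewrite negb_forall => /existsP[j].
  rewrite negb_imply negb_and -ltnNge => /andP[j0 /orP[bj|]].
    exists j, j; rewrite j0 leqnn; split=> //; apply/mnm_lepP=> u.
    by rewrite mnmDE mulmnE mnm1E; case: eqP => [<-|] //; rewrite mul1n add1n.
  rewrite negb_imply negb_forall => /andP[/eqP jb /existsP[i]].
  rewrite negb_imply => /andP[/andP[i0 ij] ei]; exists i, j; rewrite i0 ltnW //; split=> //.
  apply/mnm_lepP=> u; rewrite mnmDE mulmnE !mnm1E.
  case: (eqVneq i u) => [<-|_].
    rewrite (_ : (j == i) = false) ?mul0n ?addn0 ?lt0n //.
    by apply/negbTE; rewrite neq_ltn ij orbT.
  by case: eqP => [<-|] //; rewrite jb mul1n.
have [m [mw mp]] := rewrite_step ij; exists (e - (U_(i) + U_(j) *+ b) + m)%MM.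
have eE v : wdeg v e = (wdeg v (e - (U_(i) + U_(j) *+ b)) + (v i + b * v j))%N.
  by rewrite -{1}(submK le) !wdegD !wdegMn !wdegU.
by rewrite wdegD mw [wdeg potential e]eE wdegD -eE ltn_add2l.
Qed.

Lemma wdeg_potential_le e : (wdeg potential e <= n0 * wdeg w e)%N.
Proof.
rewrite big_distrr; apply: leq_sum => i _ /=; rewrite mulnCA leq_mul2l.
apply/orP; right; apply: leq_trans (leq_subr _ _) _.
by rewrite leq_pmulr ?repunit_weight_gt0.
Qed.

(** Each improvement keeps the degree, hence the bound of [wdeg_potential_le], and uses up some of
    the room below it. *)
Lemma standard_exists e : exists f,
  [/\ standard f, wdeg w f = wdeg w e & (wdeg potential e <= wdeg potential f)%N].
Proof.
have [N] := ubnP (n0 * wdeg w e - wdeg potential e)%N.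
elim: N e => // N IHN e; rewrite ltnS => eN.
have [en|/not_standard_improve[g [gw gp]]] := boolP (standard e); first by exists e.
have := wdeg_potential_le g; rewrite gw => gle.
case: (IHN g) => [|f [fn fw fp]]; first by rewrite gw; lia.
by exists f; split=> //; [rewrite fw | lia].
Qed.

(** The exponents of a standard monomial are the digits of a greedy expansion along
    [r (i+1) = b * r i + 1]: a digit [b] is allowed only with zeros below it. Since [r 0 = 0], the
    exponent of [x_1] does not count. *)
Lemma standard_sum_lt e p : standard e -> (p < n)%N ->
  (\sum_(0 <= i < p.+1) e (inord i) * r i < r p.+1)%N.
Proof.
move=> /standardP en; elim: p => [|p IHp] pn.
  by rewrite big_nat1 repunitS [repunit b 0]big_geq // !muln0.
rewrite big_nat_recr //= (repunitS b p.+1).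
have lt1 := IHp (ltnW pn).
have := en (inord p.+1); rewrite inordK // => /(_ isT)[le eb].
have [eqb|neb] := eqVneq (e (inord p.+1)) b.
  rewrite eqb big_nat big1 ?add0n ?addn1 // => i /andP[_ ip].
  case: i ip => [|i] ip; first by rewrite [repunit b 0]big_geq // muln0.
  by rewrite eb // inordK // (ltn_trans ip pn).
have {le neb}: (e (inord p.+1) < b)%N by rewrite ltn_neqAle neb le.
by move: (e _) (repunit b p.+1) (bigop _ _ _) lt1 => x y z; nia.
Qed.

Lemma standard_sum_inj e f p : standard e -> standard f -> (p < n)%N ->
  (\sum_(0 <= i < p.+1) e (inord i) * r i =
   \sum_(0 <= i < p.+1) f (inord i) * r i)%N ->
  forall i, (0 < i <= p)%N -> e (inord i) = f (inord i).
Proof.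
move=> en fn; elim: p => [|p IHp] pn; first by move=> _ i; case: ltnP => // i0 /(leq_trans i0).
rewrite !(big_nat_recr p.+1) //= => E.
have lte := standard_sum_lt en (ltnW pn); have ltf := standard_sum_lt fn (ltnW pn).
have r0 : (0 < r p.+1)%N by rewrite repunitS addn1.
have ep : e (inord p.+1) = f (inord p.+1).
  by move/(congr1 (divn^~ (r p.+1))): E; rewrite !divnDMl // !divn_small.
move=> i /andP[i0]; rewrite leq_eqVlt => /predU1P[->//|ip].
by apply: IHp; rewrite ?(ltnW pn) ?i0 //; move: E; rewrite ep => /addIn.
Qed.

Lemma wdeg_repunitE e : wdeg w e =
  (r n * mdeg e + a * \sum_(0 <= i < n) e (inord i) * r i)%N.
Proof.
rewrite mdegE !big_distrr big_mkord -big_split; apply: eq_bigr => i _ /=.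
by rewrite inord_val repunit_weightE repunit_extE; ring.
Qed.

Hypothesis cop : coprime a (repunit_gen b n a 1).

(** Modulo [r n = a_1] the degree is [a] times the digit sum [rho]. Coprimality and [rho < r n]
    recover [rho], the digits recover all exponents except that of [x_1], and the total degree gives
    the last one. *)
Lemma standard_inj e f : standard e -> standard f -> wdeg w e = wdeg w f -> e = f.
Proof.
move=> en fn; rewrite !wdeg_repunitE => E.
pose rho g := (\sum_(0 <= i < n) g (inord i) * r i)%N.
have lte : (rho e < r n)%N := standard_sum_lt en (ltnSn n0).
have ltf : (rho f < r n)%N := standard_sum_lt fn (ltnSn n0).
have eqs : rho e = rho f.
  apply/eqP; rewrite -(modn_small lte) -(modn_small ltf).
  have cop' : coprime (r n) a by move: cop; rewrite coprime_sym.
  have : (a * rho e == a * rho f %[mod r n])%N.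
    have := congr1 (modn^~ (r n)) E.
    by rewrite ![(r n * _)%N]mulnC !modnMDl => /eqP.
  move: (rho e) (rho f) => x y.
  wlog le : x y / (y <= x)%N => [H h|].
    case/orP: (leq_total y x) => le; first exact: H.
    by rewrite eq_sym; apply: H => //; rewrite eq_sym.
  by rewrite !eqn_mod_dvd ?leq_mul // -mulnBr Gauss_dvdr.
have eqi := standard_sum_inj en fn (ltnSn n0) eqs.
have eqi' i : (0 < i)%N -> e i = f i.
  by move=> i0; have := eqi i; rewrite inord_val i0 -ltnS ltn_ord; apply.
have : mdeg e = mdeg f.
  move: E; rewrite -/(rho e) eqs => /addIn /eqP; rewrite eqn_mul2l repunitS addn1 /=.
  by move/eqP.
rewrite !mdegE !big_ord_recl (eq_bigr (fun i : 'I_n0 => f (lift ord0 i))) => [|i _].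
  2: exact: eqi'.
move=> /addIn e0; apply/mnmP=> i; case: (posnP i) => [i0|/eqi' //].
by rewrite (_ : i = ord0) //; apply: val_inj.
Qed.

Lemma standard_max f g : standard f -> wdeg w g = wdeg w f -> g != f ->
  (wdeg potential g < wdeg potential f)%N.
Proof.
move=> fn gw gf; have [gn|/not_standard_improve[h [hw hp]]] := boolP (standard g).
  by case/eqP: gf; apply: standard_inj.
have [f' [f'n f'w f'p]] := standard_exists h.
rewrite (_ : f = f'); first exact: leq_trans hp f'p.
by apply: standard_inj; rewrite // f'w hw gw.
Qed.

End NormalForm.

(** * The matching *)

Lemma ord_gt0 (n : nat) (T : {set 'I_n.+1}) u : ord0 \notin T -> u \in T -> (0 < u)%N.
Proof.
move=> T0 uT; rewrite lt0n; apply: contraNneq T0 => u0.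
by rewrite (_ : ord0 = u) //; apply: val_inj.
Qed.

Section Pivot.

Variables (b n0 : nat).
Local Notation n := n0.+1.
Hypotheses (b_gt1 : (1 < b)%N).
Implicit Types (e f g m : 'X_{1..n}) (i j t u : 'I_n) (T : {set 'I_n}).

(** The basis elements [1] and [x^(b-1) dx] that survive in the Koszul homology of [k[x]/(x^b)]. *)
Definition settled e T u := e u == (if u \in T then b.-1 else 0%N).

(* [T] is matched with [T :\ t], the monomial [x^e] becoming [x^e x_t]: as in
   the Koszul homology of [k[x]/(x^b)], [x^e dx] is matched with [x^(e+1)]
   for the first possible index in the order [0, n0, n0 - 1, ..., 1]. *)
Definition pivot e T t := (t \in T) && ((t == ord0) ||
  [&& e ord0 == 0%N, ord0 \notin T,
      [forall u : 'I_n, (t < u)%N ==> settled e T u]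
    & ((e t).+1 < b)%N || (e t == b.-1) &&
      [forall u : 'I_n, (0 < u < t)%N ==> (u \notin T) && (e u == 0%N)]]).

Variant pivot_spec e T t : Prop :=
| PivotZero of t \in T & t = ord0
| PivotPos of t \in T & (0 < t)%N & e ord0 = 0%N & ord0 \notin T
    & (forall u, (t < u)%N -> settled e T u)
    & ((e t).+1 < b)%N \/ e t = b.-1 /\
        (forall u, (0 < u < t)%N -> u \notin T /\ e u = 0%N).

Lemma pivotP e T t : reflect (pivot_spec e T t) (pivot e T t).
Proof.
apply: (iffP andP) => [[tT /orP[/eqP t0|]]|].
- exact: PivotZero.
- case/and4P=> /eqP e0 T0 /forall_inP up low.
  apply: PivotPos => //.
    exact: ord_gt0 tT.
  case/orP: low => [->|/andP[/eqP -> /forall_inP low]]; [by left|right; split=> // u].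
  by move=> /low /andP[-> /eqP ->].
case=> [tT t0|tT t0 e0 T0 up low]; first by rewrite t0 eqxx -t0.
split=> //; apply/orP; right; rewrite e0 T0 /=; apply/andP; split.
  by apply/forall_inP.
apply/orP; case: low => [->|[-> low]]; [by left|right; rewrite eqxx].
by apply/forall_inP=> u /low[-> ->].
Qed.

Lemma settled_lt e T u : settled e T u -> (e u < b)%N.
Proof. by move=> /eqP ->; case: ifP => _; lia. Qed.

Lemma standard_pivot e T t : standard b e -> pivot e T t -> standard b (e + U_(t)).
Proof.
move=> /standardP en /pivotP tp; apply/standardP=> j j0.
have [le eb] := en j j0; rewrite mnmDE mnm1E.
case: (eqVneq t j) => [tj|ntj]; last first.
  rewrite addn0; split=> // ejb i /andP[i0 ij]; rewrite mnmDE mnm1E eb ?i0 // add0n.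
  case: eqP => // ti; case: tp => [_ t0|tT _ e0 T0 up low]; first by rewrite -ti t0 in i0.
  have tj : (t < j)%N by rewrite ti.
  by have := settled_lt (up _ tj); rewrite ejb ltnn.
case: tp => [_ t0|tT _ e0 T0 up low]; first by rewrite -tj t0 in j0.
rewrite -tj addn1; case: low => [lt|[tb low]].
  by split; [exact: ltnW|move=> E; rewrite E ltnn in lt].
split; first by rewrite tb; lia.
move=> _ i ij; have [iT ei] := low i ij; rewrite mnmDE mnm1E ei.
by rewrite (_ : (t == i) = false) //; apply/negbTE; rewrite neq_ltn orbC (andP ij).2.
Qed.

(** If [t < u] with [t] positive, then [u] is settled with exponent [b - 1], so it can only be a
    pivot by the last alternative, which forbids [t] in [T]. *)
Lemma pivot_uniq e T t u : pivot e T t -> pivot e T u -> t = u.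
Proof.
suff H t' u' : pivot e T t' -> pivot e T u' -> (t' < u')%N -> False.
  move=> tp up; apply: val_inj; case: (ltngtP t u) => // lt; first by case: (H t u).
  by case: (H u t).
move=> /pivotP tp /pivotP up tu.
case: up => [_ u0|uT u0 e0 T0 _ low]; first by rewrite u0 in tu.
case: tp => [tT t0|tT t0 _ _ up _]; first by rewrite t0 (negbTE T0) in tT.
have := up _ tu; rewrite /settled uT => /eqP eu.
case: low => [|[_ /(_ t')]]; first by rewrite eu; lia.
by rewrite t0 tu tT => /(_ isT)[].
Qed.

Lemma pivot_disjoint e T t u : pivot e T t -> ~~ pivot (e + U_(t)) (T :\ t) u.
Proof.
move=> /pivotP tp; apply/negP=> /pivotP up.
have ft : (e + U_(t))%MM t = (e t).+1 by rewrite mnmDE mnm1E eqxx addn1.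
have fu v : v != t -> (e + U_(t))%MM v = e v.
  by move=> vt; rewrite mnmDE mnm1E eq_sym (negbTE vt) addn0.
case: tp => [tT t0|tT t0 e0 T0 upt low].
  case: up => [|_ _]; last by rewrite -t0 ft.
  by rewrite !inE t0 => /andP[/eqP].
case: up => [|]; rewrite !inE.
  by move=> /andP[_ uT] u0; rewrite u0 (negbTE T0) in uT.
move=> /andP[ut uT] u0 _ _ upu lowu.
case: (ltngtP u t) => [lt|lt|/val_inj e1]; last by rewrite e1 eqxx in ut.
  by have := upu _ lt; rewrite /settled ft !inE eqxx.
have := upt _ lt; rewrite /settled uT => /eqP eu.
case: lowu => [|[_ /(_ t)]]; first by rewrite fu // eu; lia.
by rewrite t0 lt ft => /(_ isT)[].
Qed.

(** Excludes ties: the monomial of another matched coface of [T :\ t] must differ from the standard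
    one [x^e x_t], so [standard_max] applies to it strictly. *)
Lemma pivot_not_matched e e' T t t' u : pivot e T t -> t' \notin T ->
  (e' + U_(t') = e + U_(t))%MM -> ~~ pivot e' (t' |: (T :\ t)) u.
Proof.
move=> /pivotP tp t'T E; apply/negP=> /pivotP up.
have tT : t \in T by case: tp.
have t't : t' != t by apply: contraNneq t'T => ->.
have ev v : (e' v + (t' == v) = e v + (t == v))%N.
  by have /mnmP/(_ v) := E; rewrite !mnmDE !mnm1E.
have et : e' t = (e t).+1 by have := ev t; rewrite (negbTE t't) eqxx addn0 addn1.
have et' : e t' = (e' t').+1.
  by have := ev t'; rewrite eqxx eq_sym eq_sym (eq_sym t) (negbTE t't) addn0 addn1.
case: tp => [_ t0|_ t0 e0 T0 upt low].
  case: up => [|_ _]; last by rewrite -t0 et.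
  rewrite !inE => /predU1P[ut' u0|/andP[ut _] u0]; last by rewrite u0 t0 eqxx in ut.
  by rewrite -ut' u0 -t0 eqxx in t't.
have t'0 : t' != ord0 by apply: contra_eq_neq et' => ->; rewrite e0.
have t'lt : (t' < t)%N.
  case: (ltngtP t' t) => // [lt|/val_inj e1]; last by rewrite e1 eqxx in t't.
  by have := upt _ lt; rewrite /settled (negbTE t'T) et'.
have t'pos : (0 < t')%N by rewrite lt0n; apply: contra t'0 => /eqP h; apply/eqP/val_inj.
case: up => [|]; rewrite !inE.
  by move=> + u0; rewrite u0 eq_sym (negbTE t'0) (negbTE T0) andbF.
move=> uT u0 _ _ upu lowu; case: (ltngtP u t) => [lt|lt|/val_inj e1].
- by have := upu _ lt; rewrite /settled et !inE eqxx (eq_sym t) (negbTE t't).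
- have ut : u != t by rewrite neq_ltn lt orbT.
  have ut' : u != t' by rewrite neq_ltn (ltn_trans t'lt lt) orbT.
  rewrite (negbTE ut') ut /= in uT.
  have := upt _ lt; rewrite /settled uT => /eqP eu.
  have eu' : e' u = e u by have := ev u; rewrite !(eq_sym _ u) (negbTE ut) (negbTE ut') !addn0.
  case: lowu => [|[_ /(_ t)]]; first by rewrite eu' eu; lia.
  by rewrite t0 lt et => /(_ isT)[].
by rewrite e1 (eq_sym t) (negbTE t't) eqxx in uT.
Qed.

(** [q] is the largest unsettled positive index. Were all settled, the least element of [T] would be
    a pivot. An exponent below [b] at [q] would allow a move of [x_q] in one direction or the other,
    and with exponent [b] and no element of [T] up to [q], the last alternative of [pivot] would
    move [x_q] into [T]. *)
Lemma unmatched_critical e T : standard b e -> T != set0 ->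
  (forall t, ~~ pivot e T t) ->
  (forall t f, t \notin T -> e = (f + U_(t))%MM -> ~~ pivot f (t |: T) t) ->
  exists q : 'I_n, [/\ (0 < q)%N /\ e q = b,
    forall u, (q < u)%N -> settled e T u,
    forall u, (u < q)%N -> e u = 0%N,
    ord0 \notin T & exists2 t, t \in T & (t <= q)%N].
Proof.
move=> /standardP en Tn0 noD noU.
have T0 : ord0 \notin T.
  by apply: contra (noD ord0) => T0; apply/pivotP; apply: PivotZero.
have eU t : (0 < e t)%N -> (e - U_(t) + U_(t))%MM = e.
  by move=> et; rewrite submK //; apply/mnm_lepP=> u; rewrite mnm1E; case: eqP => [<-|].
have e0 : e ord0 = 0%N.
  apply/eqP; rewrite -leqn0 leqNgt; apply/negP=> e0.
  have /negP[] := noU ord0 _ T0 (esym (eU _ e0)).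
  by apply/pivotP; apply: PivotZero; rewrite ?inE ?eqxx.
have [t1 t1P|all_settled] := pickP (fun t : 'I_n => (0 < t)%N && ~~ settled e T t); last first.
  have {}all_settled t : (0 < t)%N -> settled e T t.
    by move=> t0; have := all_settled t; rewrite t0 => /negbFE.
  have /set0Pn[t1 t1T] := Tn0.
  case: (@arg_minnP _ t1 (fun t => t \in T) (@nat_of_ord n) t1T) => t tT tmin.
  have t0 : (0 < t)%N.
    exact: ord_gt0 tT.
  have /negP[] := noD t; apply/pivotP; apply: PivotPos => //.
    by move=> u tu; apply: all_settled; apply: ltn_trans tu.
  right; split; first by have := all_settled t t0; rewrite /settled tT => /eqP.
  move=> u /andP[u0 ut]; have uT : u \notin T.
    by apply/negP=> /tmin; rewrite leqNgt ut.
  by split=> //; have := all_settled u u0; rewrite /settled (negbTE uT) => /eqP.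
case: (@arg_maxnP _ t1 (fun t : 'I_n => (0 < t)%N && ~~ settled e T t)
  (@nat_of_ord n) t1P) => t /andP[t0 tns] tmax.
have up u : (t < u)%N -> settled e T u.
  move=> tu; apply/negPn/negP=> us; have := tmax u; rewrite /= us (ltn_trans t0 tu) => /(_ isT).
  by rewrite /= leqNgt tu.
have upf u : (t < u)%N -> settled (e - U_(t)) (t |: T) u.
  move=> tu; have := up u tu; rewrite /settled !inE mnmBE mnm1E.
  have -> : (u == t) = false by apply/negbTE; rewrite neq_ltn tu orbT.
  have -> : (t == u) = false by apply/negbTE; rewrite neq_ltn tu.
  by rewrite subn0.
have [le lowz] := en t t0.
have noUt : t \notin T -> (0 < e t)%N -> ~ ((e t < b)%N \/ e t = b /\
    (forall u, (0 < u < t)%N -> u \notin T)).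
  move=> tT et low; have /negP[] := noU t _ tT (esym (eU _ et)).
  apply/pivotP; apply: PivotPos => //.
  - by rewrite setU11.
  - by rewrite mnmBE e0.
  - by rewrite !inE negb_or T0 andbT; apply: contraTneq t0 => <-.
  case: low => [lt|[E low]]; [left|right]; rewrite mnmBE mnm1E eqxx.
    by rewrite subn1 prednK.
  rewrite E subn1; split=> // u ut; rewrite mnmBE (lowz E u ut) !inE negb_or low // andbT.
  by split=> //; rewrite neq_ltn; case/andP: ut => _ ->.
have etb : e t = b.
  apply/eqP; rewrite eqn_leq le leqNgt; apply/negP=> lt.
  have [tT|tT] := boolP (t \in T).
    have /negP[] := noD t; apply/pivotP; apply: PivotPos => //; left.
    by rewrite /settled tT in tns; move/eqP: tns => tns; lia.
  rewrite /settled (negbTE tT) -lt0n in tns.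
  by apply: (noUt tT tns); left.
exists t; split=> //.
  move=> u ut; case: (posnP u) => [u0|u0]; last by apply: lowz; rewrite // u0.
  by rewrite (_ : u = ord0) //; apply: val_inj.
have [u /andP[uT ut]|no] := pickP (fun u : 'I_n => (u \in T) && (u <= t)%N); first by exists u.
have tT : t \notin T by have := no t; rewrite leqnn andbT => ->.
case: (noUt tT); first by rewrite etb ltnW.
right; split=> // u /andP[_ ut]; have := no u.
by rewrite (ltnW ut) andbT => ->.
Qed.

End Pivot.

(** * Unmatched faces *)

Section EagonNorthcottPairs.

Variables (b n0 a : nat).
Local Notation n := n0.+1.
Hypothesis b_gt1 : (1 < b)%N.
Implicit Types (e f m : 'X_{1..n}) (i t u q : 'I_n) (I T : {set 'I_n}).
Implicit Types (p : {set 'I_n} * 'I_n).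
Local Notation w := (@repunit_weight b n a).

(* [(I, q)] stands for the degree with [{i_1 < ... < i_(j+1)} = I + 2] and
   [k] the number of elements of [I] that are at least [q]; [k <= j] means
   that [q] is not the least element of [I]. *)
Definition pairs j : {set {set 'I_n} * 'I_n} :=
  [set p : {set 'I_n} * 'I_n | [&& #|p.1| == j.+1, p.2 \in p.1 &
    [exists i : 'I_n in p.1, (i < p.2)%N]]].

Definition pair_height p : nat := #|[set i : 'I_n in p.1 | (p.2 <= i)%N]|.

Definition pair_degree p : int :=
  (pair_height p)%:Z * repunit_c b n a + (\sum_(i in p.1) repunit_ext b n a i.+2)%N%:Z.

Definition pair_face p : {set 'I_n} :=
  [set u : 'I_n | if (u <= p.2)%N then [exists i : 'I_n in p.1, i.+1 == u :> nat] else u \in p.1].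

(** With the shift by 2, an element [u <= q] of [T] keeps its own generator [a_(u+1)], whereas [q]
    and the elements [u > q] contribute [a_(u+2)], the generator in [b * a_(u+1) = a_(u+2) + c]. *)
Definition face_pair T q : {set 'I_n} * 'I_n :=
  ([set i : 'I_n | if (i < q)%N then [exists u : 'I_n in T, i.+1 == u :> nat]
                   else (i == q) || (i \in T)], q).

Lemma face_pairK T q : ord0 \notin T -> pair_face (face_pair T q) = T.
Proof.
move=> T0; apply/setP=> u; rewrite inE /=; case: ltnP => [qu|uq].
  by rewrite inE ltnNge ltnW // orbC -(inj_eq val_inj) gtn_eqF ?orbF.
apply/exists_inP/idP => [[i iT /eqP iu]|uT].
  move: iT; rewrite inE iu uq => /exists_inP[v vT]; rewrite (inj_eq val_inj).
  by move=> /eqP ->.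
have u0 : (0 < u)%N.
  exact: ord_gt0 uT.
have lt : (u.-1 < n)%N by apply: leq_ltn_trans (leq_pred u) _.
exists (Ordinal lt); rewrite ?inE /= prednK // uq.
by apply/exists_inP; exists u.
Qed.

Lemma face_pair_sum T q (g : nat -> nat) : ord0 \notin T ->
  (\sum_(i in (face_pair T q).1) g i.+1 =
   \sum_(u in T | u <= q) g u + (g q.+1 + \sum_(u in T | q < u) g u.+1))%N.
Proof.
move=> T0; rewrite (bigID (fun i : 'I_n => i < q)%N) /=; congr (_ + _)%N; last first.
  rewrite (bigD1 q) /=; last by rewrite inE ltnn eqxx.
  congr (_ + _)%N; apply: eq_bigl => i; rewrite inE.
  case: (ltngtP i q) => [iq|iq|/val_inj ->]; rewrite ?andbF ?ltnn ?eqxx ?andbF //=.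
  by rewrite -(inj_eq val_inj) gtn_eqF //= !andbT.
rewrite (reindex_onto (fun u : 'I_n => inord u.-1 : 'I_n) (fun i => inord i.+1)) /=; last first.
  move=> i /andP[_ iq]; have lt : (i.+1 < n)%N by apply: leq_ltn_trans iq _.
  by rewrite inordK //= inord_val.
have uE u : nat_of_ord (inord u.-1 : 'I_n) = u.-1.
  by rewrite inordK //; apply: leq_ltn_trans (leq_pred u) _.
apply: eq_big => [u|u].
  rewrite inE uE; case: (posnP u) => [u0|u0].
    rewrite u0 /= (_ : u \in T = false) ?andFb; last first.
      by apply: contraNF T0 => uT; rewrite (_ : ord0 = u) //; apply: val_inj.
    apply/negP=> /andP[/andP[_ q0] /eqP /(congr1 val)].
    by rewrite /= inordK ?u0 // ltnS (leq_trans q0) // -ltnS.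
  rewrite prednK // inord_val eqxx andbT.
  rewrite andbC [RHS]andbC; case: (u <= q)%N => //=.
  apply/exists_inP/idP => [[v vT]|uT]; last by exists u.
  by rewrite (inj_eq val_inj) => /eqP ->.
case/andP=> /andP[_ uq] /eqP E; congr g; rewrite uE in uq.
have := congr1 (@nat_of_ord n) E; rewrite inordK uE //.
by rewrite ltnS (leq_trans uq) // -ltnS.
Qed.

Lemma face_pair_card T q : ord0 \notin T -> #|(face_pair T q).1| = #|T|.+1.
Proof.
move=> T0; rewrite -sum1_card (face_pair_sum q (fun=> 1%N) T0) addnCA add1n.
congr _.+1; rewrite -(sum1_card (mem T)) [RHS](bigID (fun i : 'I_n => i <= q)%N) /=.
by congr (_ + _)%N; apply: eq_bigl => u; rewrite ltnNge.
Qed.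

Lemma face_pair_height T q : ord0 \notin T ->
  pair_height (face_pair T q) = (\sum_(u in T | q < u) 1).+1%N.
Proof.
move=> T0; pose g (i : nat) := nat_of_bool (q < i)%N.
have -> : pair_height (face_pair T q) = (\sum_(i in (face_pair T q).1) g i.+1)%N.
  rewrite /pair_height -sum1_card big_mkcond [RHS]big_mkcond /=.
  apply: eq_bigr => i _; rewrite [X in if X then _ else _]inE /g ltnS.
  by case: (i \in _); case: leqP.
rewrite face_pair_sum // big1 => [|u /andP[_ uq]]; last by rewrite /g ltnNge uq.
rewrite add0n /g leqnn add1n; congr _.+1; apply: eq_bigr => u /andP[_ qu].
by rewrite ltnS ltnW.
Qed.

(** An element [u > q] of [T] counts [b - 1] times in the monomial and once in the face, and [q]
    counts [b] times in the monomial. Each of these multiples of [b] yields one [c], and their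
    number is the height. *)
Lemma critical_degree e T q s : (wdeg w e + set_weight w T)%N%:Z = s ->
  e q = b -> (forall u, (q < u)%N -> settled b e T u) ->
  (forall u, (u < q)%N -> e u = 0%N) -> ord0 \notin T ->
  pair_degree (face_pair T q) = s.
Proof.
move=> <- eq up low T0; rewrite /pair_degree face_pair_height //.
have := face_pair_sum q (fun i : nat => repunit_ext b n a i.+1) T0; rewrite /= => ->.
have we : wdeg w e = (b * w q + \sum_(u in T | (q < u)%N) b.-1 * w u)%N.
  rewrite /wdeg (bigD1 q) //= eq; congr (_ + _)%N.
  rewrite [RHS]big_mkcond [LHS]big_mkcond /=; apply: eq_bigr => u _.
  case: (ltngtP u q) => [uq|uq|/val_inj ->]; rewrite ?andbF ?eqxx //=.
    by rewrite low // if_same.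
  by rewrite -(inj_eq val_inj) gtn_eqF //= andbT (eqP (up u uq)); case: ifP.
have wT : (set_weight w T =
    \sum_(u in T | (u <= q)%N) w u + \sum_(u in T | (q < u)%N) w u)%N.
  rewrite /set_weight (bigID (fun i : 'I_n => i <= q)%N) /=.
  by congr (_ + _)%N; apply: eq_bigl => u; rewrite ltnNge.
rewrite we wT.
have -> : (b * w q + \sum_(u in T | (q < u)%N) b.-1 * w u +
  (\sum_(u in T | (u <= q)%N) w u + \sum_(u in T | (q < u)%N) w u) =
  \sum_(u in T | (u <= q)%N) w u + (b * w q + \sum_(u in T | (q < u)%N) b * w u))%N.
  rewrite (eq_bigr (fun u => b.-1 * w u + w u)%N (F1 := fun u => b * w u)%N); last first.
    by move=> u _; rewrite -{1}(prednK (ltnW b_gt1)) mulSn addnC.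
  by rewrite big_split /=; lia.
have sumZ (P : pred 'I_n) : (\sum_(u | P u) b * w u)%N%:Z =
    (\sum_(u | P u) repunit_ext b n a u.+2)%N%:Z + (\sum_(u | P u) 1)%N%:Z * repunit_c b n a.
  elim/big_rec3: _ => [|u x y z _ IH]; first by rewrite mul0r.
  by rewrite !PoszD repunit_weightE repunit_ext_step IH mulrDl mul1r addrACA.
have -> : (\sum_(u in T | (u <= q)%N) w u =
    \sum_(u in T | (u <= q)%N) repunit_ext b n a u.+1)%N.
  by apply: eq_bigr => u _; rewrite repunit_weightE.
rewrite !PoszD sumZ repunit_weightE repunit_ext_step [in LHS]intS.
by ring.
Qed.

End EagonNorthcottPairs.

(** * Counting *)

Lemma ord_set_min n0 (I : {set 'I_n0.+1}) : I != set0 ->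
  exists2 i, i \in I & forall u : 'I_n0.+1, u \in I -> (i <= u)%N.
Proof.
case/set0Pn => i0 i0I.
case: (@arg_minnP _ i0 (fun t => t \in I) (@nat_of_ord _) i0I) => i iI imin.
by exists i.
Qed.

Lemma card_pairs n0 j : #|pairs n0 j| = (j * 'C(n0.+1, j.+1))%N.
Proof.
rewrite -sum1_card /pairs.
rewrite (eq_bigl (fun p : {set 'I_n0.+1} * 'I_n0.+1 => (#|p.1| == j.+1) &&
   ((p.2 \in p.1) && [exists i in p.1, (i < p.2)%N]))); last by move=> p; rewrite inE.
rewrite -(pair_big_dep (fun I : {set 'I_n0.+1} => #|I| == j.+1)
  (fun (I : {set 'I_n0.+1}) (q : 'I_n0.+1) => (q \in I) && [exists i in I, (i < q)%N])
  (fun _ _ => 1%N)) /=.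
have -> : 'C(n0.+1, j.+1) = #|[set I : {set 'I_n0.+1} | #|I| == j.+1]|.
  by rewrite card_draws card_ord.
rewrite mulnC -sum_nat_const; apply: eq_big => [I|I /eqP Ij]; first by rewrite inE.
have [|i iI imin] := @ord_set_min _ I; first by rewrite -card_gt0 Ij.
rewrite (eq_bigl (mem (I :\ i))) ?sum1_card => [|q].
  by apply/eqP; rewrite -eqSS -Ij (cardsD1 i I) iI.
rewrite !inE [RHS]andbC; apply: andb_id2l => qI.
apply/exists_inP/idP => [[u uI uq]|qi].
  by apply: contraTneq uq => ->; rewrite -leqNgt imin.
by exists i => //; rewrite ltn_neqAle eq_sym (inj_eq val_inj) qi imin.
Qed.

(** The height is the position of [q] counted from the top, unaffected by removing the least element
    when [q] is another one. *)
Lemma exists_height n0 (I : {set 'I_n0.+1}) k : (0 < k <= #|I|)%N ->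
  exists2 q, q \in I & pair_height (I, q) = k.
Proof.
have [N] := ubnP #|I|; elim: N I => // N IHN I; rewrite ltnS => IN /andP[k0 kI].
have [|m mI mmin] := @ord_set_min _ I; first by rewrite -card_gt0 (leq_trans k0).
have hm : pair_height (I, m) = #|I|.
  apply: eq_card => i; rewrite inE /=.
  by case: (boolP (i \in I)) => //= /mmin ->.
have [kE|kne] := eqVneq k #|I|; first by exists m; rewrite // hm.
have cI : #|I| = #|I :\ m|.+1 by rewrite (cardsD1 m I) mI.
have [||q] := IHN (I :\ m); first by rewrite -cI.
  by rewrite k0 -ltnS -cI ltn_neqAle kne.
rewrite !inE => /andP[qm qI] hq; exists q => //; rewrite -hq; apply: eq_card => i.
rewrite !inE /=; case: (eqVneq i m) => [->|//]; rewrite andbC /=.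
apply/negP=> /andP[qlem _]; case/eqP: qm.
by apply: val_inj; apply/eqP; rewrite eqn_leq qlem mmin.
Qed.

Lemma repunit_shiftsP b n0 a j s :
  repunit_shifts b n0.+1 a j s <->
  exists2 p, p \in pairs n0 j & pair_degree b a p = s.
Proof.
split=> [[k [i [kj ip iall ->]]]|[[I q]]].
  have := ip; rewrite (path_sortedE ltn_trans) => /andP[/allP i1 isort].
  have iu : uniq i by apply: sorted_uniq isort; [exact: ltn_trans|exact: ltnn].
  pose I := [set x : 'I_n0.+1 | x.+2 \in (i : seq nat)].
  have iI : perm_eq i [seq x.+2 | x : 'I_n0.+1 <- enum I].
    apply: uniq_perm => //.
      by rewrite map_inj_uniq ?enum_uniq // => x y [] /val_inj.
    move=> x; apply/idP/mapP => [xi|[y]]; last by rewrite mem_enum inE => ? ->.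
    have x1 := i1 _ xi; have xn : (x <= n0.+2)%N := allP iall _ xi.
    have xE : x = x.-2.+2 by move: (x) x1 => [|[]].
    have lt : (x.-2 < n0.+1)%N by rewrite -2!ltnS -xE ltnS.
    by exists (Ordinal lt); rewrite // mem_enum inE /= -xE.
  have cI : #|I| = j.+1.
    by rewrite cardE -(size_map (fun x : 'I_n0.+1 => x.+2)) -(perm_size iI) size_tuple.
  have [|q qI hq] := @exists_height _ I k.
    by case/andP: kj => -> /= kj; rewrite cI leqW.
  exists (I, q); last first.
    by rewrite /pair_degree hq (perm_big _ iI) /= big_map big_enum.
  rewrite inE /= cI eqxx qI /=; apply: contraT => noi; exfalso.
  suff : pair_height (I, q) = #|I| by rewrite hq cI => kE; move: kj; rewrite kE ltnn andbF.
  apply: eq_card => u; rewrite inE /=; apply: andb_idr => uI.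
  by rewrite leqNgt; apply: contra noi => uq; apply/exists_inP; exists u.
rewrite inE /= => /and3P[/eqP cI qI /exists_inP[u uI uq]] <-.
have sz : size [seq x.+2 | x : 'I_n0.+1 <- enum I] == j.+1 by rewrite size_map -cardE cI.
exists (pair_height (I, q)), (Tuple sz); split.
- apply/andP; split; first by rewrite card_gt0; apply/set0Pn; exists q; rewrite inE qI /=.
  rewrite -ltnS -cI; apply: proper_card; apply/properP; split.
    by apply/subsetP=> v; rewrite inE => /andP[].
  by exists u; rewrite // inE /= uI /= -ltnNge.
- rewrite (path_sortedE ltn_trans); apply/andP; split.
    by apply/allP=> x /mapP[y _ ->].
  rewrite sorted_map; have -> : enum I = [seq x <- enum 'I_n0.+1 | x \in I].
    by rewrite {1}/enum_mem -enumT.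
  apply: sorted_filter; first by move=> x y z /=; rewrite !ltnS; apply: ltn_trans.
  by have := iota_ltn_sorted 0 n0.+1; rewrite -val_enum_ord sorted_map.
- by apply/allP=> x /mapP[y _ ->]; rewrite !ltnS -ltnS.
by rewrite /pair_degree /= big_map big_enum.
Qed.

(** The fiberwise bounds make the list of values of [f] a permutation of a subsequence of that of
    [g]; equal lengths leave no room for a proper one. *)
Lemma image_eq_of_card_le (A B : finType) (Z : eqType) (P : {set B})
  (f : A -> Z) (g : B -> Z) :
  #|A| = #|P| ->
  (forall z, (#|[set x | f x == z]| <= #|[set y in P | g y == z]|)%N) ->
  forall z, (exists x, f x = z) <-> (exists2 y, y \in P & g y = z).
Proof.
move=> AP fg z.
have cf z' : count_mem z' [seq f x | x <- enum A] = #|[set x | f x == z']|.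
  rewrite count_map -size_filter cardE; congr size.
  by rewrite [RHS]/enum_mem -enumT; apply: eq_filter => x; rewrite /= inE.
have cg z' : count_mem z' [seq g y | y <- enum P] = #|[set y in P | g y == z']|.
  rewrite count_map -size_filter cardE; congr size.
  by rewrite /enum_mem -filter_predI; apply: eq_filter => y; rewrite /= inE andbC.
have [|s sub perm] := (count_subseqP [seq f x | x <- enum A] [seq g y | y <- enum P]).1.
  by move=> z'; rewrite cf cg.
have sE : s = [seq g y | y <- enum P].
  apply/eqP; rewrite -(size_subseq_leqif sub) -(perm_size perm) !size_map.
  by rewrite -enumT -cardT -cardE AP.
have mem : ([seq f x | x <- enum A] : seq Z) =i [seq g y | y <- enum P].
  by move=> z'; rewrite (perm_mem perm) sE.
split=> [[x <-]|[y yP <-]].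
  have : f x \in [seq f x | x <- enum A] by rewrite map_f ?mem_enum.
  by rewrite mem => /mapP[y]; rewrite mem_enum => yP ->; exists y.
have : g y \in [seq g y | y <- enum P] by rewrite map_f ?mem_enum.
by rewrite -mem => /mapP[x _ ->]; exists x.
Qed.

(** * The matching in a fixed degree and the bound on generators *)

Section BettiBound.

Variables (k : fieldType) (b n0 a : nat).
Local Notation n := n0.+1.
Hypotheses (b_gt1 : (1 < b)%N) (cop : coprime a (repunit_gen b n a 1)).
Local Notation w := (@repunit_weight b n a).
Variable s : int.
Implicit Types (T : {set 'I_n}) (t : 'I_n) (e f : 'X_{1..n}).

Definition standard_in T e := standard b e && ((wdeg w e + set_weight w T)%N%:Z == s).

(** The bound on the total degree makes the search finite and loses nothing, as all weights are
    positive. *)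
Definition faces : {set {set 'I_n}} :=
  [set T | [exists e : 'X_{1..n < `|s|.+1}, standard_in T e]].

Definition standard_form T : 'X_{1..n} :=
  if [pick e : 'X_{1..n < `|s|.+1} | standard_in T e] is Some e then bmnm e else 0%MM.

Lemma mdeg_le_wdeg e : (mdeg e <= wdeg w e)%N.
Proof.
rewrite mdegE; apply: leq_sum => i _; rewrite leq_pmulr //.
exact: repunit_weight_gt0.
Qed.

Lemma facesP T : reflect (in_complex w s T) (T \in faces).
Proof.
rewrite inE; apply: (iffP existsP) => [[e /andP[_ /eqP eE]]|[e eE]]; first by exists e.
have [f [fn fw _]] := @standard_exists b n0 a b_gt1 e.
have lt : (mdeg f < `|s|.+1)%N.
  rewrite ltnS (leq_trans (mdeg_le_wdeg f)) // fw -eE absz_nat.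
  exact: leq_addr.
by exists (BMultinom lt); rewrite /standard_in fn /= fw eE.
Qed.

Lemma standard_formP T : T \in faces -> standard_in T (standard_form T).
Proof.
rewrite inE /standard_form => /existsP[e eT].
by case: pickP => [//|/(_ e)]; rewrite eT.
Qed.

Lemma standard_form_eq T e : standard_in T e -> T \in faces /\ standard_form T = e.
Proof.
move=> eT; have /andP[en /eqP eE] := eT.
have Tf : T \in faces by apply/facesP; exists e.
split=> //; have /andP[fn /eqP fE] := standard_formP Tf.
apply: (standard_inj b_gt1 cop) => //.
by move: fE; rewrite -eE => -[] /addIn.
Qed.

Definition matched : {set {set 'I_n}} :=
  [set T in faces | [exists t, pivot b (standard_form T) T t]].

Definition match_pivot T : 'I_n :=
  odflt ord0 [pick t | pivot b (standard_form T) T t].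

Definition face_rank T : nat :=
  (wdeg (@potential n0) (standard_form T) + set_weight (@potential n0) T)%N.

Lemma match_pivotP T : T \in matched ->
  T \in faces /\ pivot b (standard_form T) T (match_pivot T).
Proof.
rewrite inE /match_pivot => /andP[Tf /existsP[t tp]]; split=> //.
by case: pickP => [//|/(_ t)]; rewrite tp.
Qed.

Lemma match_pivot_eq T t : T \in faces -> pivot b (standard_form T) T t ->
  T \in matched /\ match_pivot T = t.
Proof.
move=> Tf tp; have TD : T \in matched by rewrite inE Tf; apply/existsP; exists t.
by split=> //; have [_ tp'] := match_pivotP TD; apply: pivot_uniq tp' tp.
Qed.

Lemma standard_in_remove T e t : t \in T -> pivot b e T t -> standard_in T e ->
  standard_in (T :\ t) (e + U_(t)).
Proof.
move=> tT tp /andP[en /eqP eE]; apply/andP; split; first exact: standard_pivot tp.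
by rewrite wdegD wdegU -addnA -(set_weightD1 w tT) eE.
Qed.

Lemma match_remove T : T \in matched -> let P := T :\ match_pivot T in
  P \in faces /\ standard_form P = (standard_form T + U_(match_pivot T))%MM.
Proof.
move=> TD; have [Tf tp] := match_pivotP TD; apply: standard_form_eq.
apply: standard_in_remove => //; last exact: standard_formP.
by case/andP: tp.
Qed.

Lemma face_closed T t : t \notin T -> t |: T \in faces -> T \in faces.
Proof.
move=> tT /facesP[e eE]; apply/facesP; exists (e + U_(t))%MM.
by rewrite wdegD wdegU -addnA -set_weightU.
Qed.

Lemma match_pivot_in T : T \in matched -> match_pivot T \in T.
Proof. by move=> /match_pivotP[_ /andP[]]. Qed.

(** Both faces contain [T :\ match_pivot T], so the ranks compare two distinct monomials of the same
    degree, and the one coming from [T] is standard. *)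
Lemma face_rank_lt T t : T \in matched -> t \notin T ->
  t |: (T :\ match_pivot T) \in matched ->
  (face_rank (t |: (T :\ match_pivot T)) < face_rank T)%N.
Proof.
move=> TD tT T'D; have [Tf tp] := match_pivotP TD; have [T'f tp'] := match_pivotP T'D.
have [Pf PE] := match_remove TD.
have /andP[fn /eqP fE] := standard_formP Pf.
have /andP[_ /eqP gE] := standard_formP T'f.
have pT := match_pivot_in TD.
have tP : t \notin T :\ match_pivot T by rewrite !inE (negbTE tT) andbF.
rewrite PE in fn fE; rewrite (set_weightU w tP) in gE.
have E : (standard_form (t |: (T :\ match_pivot T)) + U_(t))%MM !=
         (standard_form T + U_(match_pivot T))%MM.
  apply/negP=> /eqP eqm; move: tp'; apply/negP.
  exact: pivot_not_matched tp tT eqm.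
rewrite /face_rank (set_weightU (@potential n0) tP) (set_weightD1 (@potential n0) pT).
have := standard_max b_gt1 cop fn _ E; rewrite !wdegD !wdegU => lt.
by rewrite !addnA ltn_add2r lt //; move: fE; rewrite -gE wdegD wdegU => -[]; lia.
Qed.

Lemma match_disjoint T : T \in matched -> T :\ match_pivot T \notin matched.
Proof.
move=> TD; have [Tf tp] := match_pivotP TD; have [Pf PE] := match_remove TD.
apply/negP=> /match_pivotP[_]; rewrite PE; apply/negP; exact: pivot_disjoint.
Qed.

Lemma critical_pair T j : (0 < j)%N ->
  T \in critical faces matched match_pivot j ->
  exists2 p, p \in [set p in pairs n0 j | pair_degree b a p == s] & pair_face p = T.
Proof.
move=> j0; rewrite inE => /and4P[Tf /eqP Tj TD TU].
have /andP[en /eqP eE] := standard_formP Tf.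
have [||t|t f tT fE|q [[q0 eq] up low T0 [t tT tq]]] :=
    @unmatched_critical b n0 b_gt1 (standard_form T) T => //.
- by rewrite -card_gt0 Tj.
- by apply: contra TD => tp; have [] := match_pivot_eq Tf tp.
- apply/negP=> tp; case/negP: TU.
  have [|t'f fE'] := @standard_form_eq (t |: T) f.
    rewrite /standard_in -eE fE wdegD wdegU (set_weightU w tT) -addnA eqxx andbT.
    by rewrite fE in en; apply: standard_divisor en.
  rewrite -fE' in tp; have [tD pE] := match_pivot_eq t'f tp.
  by apply/imsetP; exists (t |: T); rewrite // pE setU1K.
exists (face_pair T q); last exact: face_pairK.
rewrite inE; apply/andP; split; last first.
  by apply/eqP; apply: (critical_degree b_gt1) eE eq up low T0.
rewrite inE face_pair_card // Tj eqxx /= inE ltnn eqxx /=.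
have t0 : (0 < t)%N.
  exact: ord_gt0 tT.
have lt : (t.-1 < n)%N by apply: leq_ltn_trans (leq_pred t) _.
apply/exists_inP; exists (Ordinal lt); last by rewrite /= prednK.
by rewrite inE /= prednK // tq; apply/exists_inP; exists t.
Qed.

Lemma card_critical_le j : (0 < j)%N ->
  (#|critical faces matched match_pivot j| <=
   #|[set p in pairs n0 j | pair_degree b a p == s]|)%N.
Proof.
move=> j0; apply: leq_trans (leq_imset_card (@pair_face n0) _).
apply: subset_leq_card; apply/subsetP=> T /critical_pair[//|p pP <-].
exact: imset_f.
Qed.

Variable F : min_graded_resolution k w.

Lemma betti_le j :
  (#|[set l : 'I_(free_rank (res_rank F) j.+1) | res_shift l == s]| <=
   #|[set p in pairs n0 j.+1 | pair_degree b a p == s]|)%N.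
Proof.
apply: leq_trans (card_critical_le (ltn0Sn j)).
set A := [set l | _].
have -> : #|A| = #|{: {l in A}}| by rewrite card_sig; apply: eq_card.
apply: (@leq_card_critical k n faces matched match_pivot face_rank _ _ _ _ _ _ _
  (fun l : {l in A} => tor_cycle (val l))).
- exact: face_closed.
- by apply/subsetP=> T; rewrite inE => /andP[].
- exact: match_pivot_in.
- exact: face_rank_lt.
- exact: match_disjoint.
- by move=> l T; apply: tor_cycle_boundary.
- move=> l T /tor_cycle_supp[Tj Ts]; split=> //; apply/facesP.
  by have := valP l; rewrite inE => /eqP <-.
move=> c g gf cg.
(* Independence is stated for all generators of [F_(j+1)], so the coefficients are extended by zero
   to those of degree other than [s]. *)
pose c' l := if insub l is Some x then c x else 0 : k.
have c'E x : c' (val x) = c x by rewrite /c' valK.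
have c'0 : forall l, c' l = 0.
  apply: (tor_cycle_indep (s := s) (g := g)).
  - move=> l; rewrite /c'; case: insubP => [x lA _ _|_]; last by rewrite eqxx.
    by move: lA; rewrite inE => /eqP.
  - by move=> T /gf /facesP.
  move=> T; rewrite -cg (bigID (mem A)) /= [X in _ + X]big1 ?addr0 => [|l lA].
    by rewrite big_sub; apply: eq_bigr => x _; rewrite c'E.
  by rewrite /c' insubN // mul0r.
by move=> l; rewrite -c'E.
Qed.

End BettiBound.

Theorem theorem10 (k : fieldType) (b n a : nat)
  (hb : (1 < b)%N) (hn : (1 < n)%N) (ha : (1 < a)%N)
  (hcop : coprime a (repunit_gen b n a 1))
  (F : min_graded_resolution k (@repunit_weight b n a))
  (hrank : forall j : nat, (1 <= j)%N -> res_rank F j = (j * 'C(n, j.+1))%N)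
  (j : nat) (hj : (1 <= j <= n.-1)%N) (s : int) :
  res_shifts F j s <-> repunit_shifts b n a j s.
Proof.
case: n hn hcop F hrank hj => // n0 _ cop F hrank /andP[j0 _].
case: j j0 => // j _; rewrite repunit_shiftsP.
apply: image_eq_of_card_le.
  by rewrite card_ord /= hrank // card_pairs.
by move=> z; apply: betti_le.
Qed.
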